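(* Let $d\ge1$, let $\nu\ge\frac d2+1$ be an integer and let $\lambda>0$. Let $\mathbf c=\{c_{\mathbf k}\}_{\mathbf k\in\Lambda}$ and $\mathbf m=\{m_{\mathbf k}\}_{\mathbf k\in\Lambda_0}$ be real with $c_{\mathbf k}=c_{-\mathbf k}$, $m_{\mathbf k}=m_{-\mathbf k}$, and assume that there is a nonnegative $\Phi_0\in L^1(\mathbb T^d)$, strictly positive on some open ball in $\mathbb T^d$, with $c_{\mathbf k}=\int_{\mathbb T^d}e^{i\langle\mathbf k,\boldsymbol\theta\rangle}\Phi_0\,\mathrm d\mu$ for all $\mathbf k\in\Lambda$. Let $(\hat P,\hat Q)$ be the (unique) solution of the continuous regularized dual problem $$\min\ J_{\nu,\lambda}(P,Q)\quad\text{s.t. }P\in\overline{\mathfrak P}_{+,o},\ Q\in\overline{\mathfrak P}_+,$$ and put $\hat\Phi_\nu=(\hat P/\hat Q)^\nu$. For $\mathbf N\in\mathbb N_+^d$ with $\min(\mathbf N)$ sufficiently large (so that the problem below is uniquely solvable), let $(\hat P_{\mathbf N},\hat Q_{\mathbf N})$ be the unique solution of the discrete regularized dual problem $$\min_{P,Q}\ J^{\mathbf N}_{\nu,\lambda}(P,Q)\quad\text{s.t. }p_{\mathbf 0}=1,\ P>0\text{ and }Q>0\text{ at every point of }\mathbb T^d_{\mathbf N},$$ and put $\hat\Phi_{\nu,\mathbf N}=(\hat P_{\mathbf N}/\hat Q_{\mathbf N})^\nu$ (on the grid $\mathbb T^d_{\mathbf N}$). Then, for any sequence of such $\mathbf N$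 with $\min(\mathbf N)\to\infty$, there exists a subsequence of the discrete measures $\hat\Phi_{\nu,\mathbf N}\,\mathrm d\eta_{\mathbf N}$ that converges to $\hat\Phi_\nu\,\mathrm d\mu$ in weak*, i.e. along it $\int_{\mathbb T^d}f\,\hat\Phi_{\nu,\mathbf N}\,\mathrm d\eta_{\mathbf N}\to\int_{\mathbb T^d}f\,\hat\Phi_\nu\,\mathrm d\mu$ for every continuous function $f$ on $\mathbb T^d$.
   Context: $\mathbb T=[0,2\pi)$, identified with the circle, so that $\boldsymbol\theta\in\mathbb T^d$ corresponds to the point $e^{i\boldsymbol\theta}=(e^{i\theta_1},\dots,e^{i\theta_d})$ of the $d$-torus (and continuity on $\mathbb T^d$ means continuity on the torus); $\mathrm d\mu(\boldsymbol\theta)=(2\pi)^{-d}\prod_{j=1}^d\mathrm d\theta_j$; $\langle\mathbf k,\boldsymbol\theta\rangle=\sum_j k_j\theta_j$. The index set $\Lambda\subset\mathbb Z^d$ is fixed, finite, contains $\mathbf 0$, and satisfies $\mathbf k\in\Lambda\Rightarrow-\mathbf k\in\Lambda$; $\Lambda_0=\Lambda\setminus\{\mathbf 0\}$. Polynomials: $P(e^{i\boldsymbol\theta})=\sum_{\mathbf k\in\Lambda}p_{\mathbf k}e^{-i\langle\mathbf k,\boldsymbol\theta\rangle}$, $Q(e^{i\boldsymbol\theta})=\sum_{\mathbf k\in\Lambda}q_{\mathbf k}e^{-i\langle\mathbf k,\boldsymbol\theta\rangle}$ with real coefficients, $p_{-\mathbf k}=p_{\mathbf k}$, $q_{-\mathbf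 k}=q_{\mathbf k}$. $\mathfrak P_+$ is the set of such polynomials strictly positive on $\mathbb T^d$; $\mathfrak P_{+,o}=\{P\in\mathfrak P_+:p_{\mathbf 0}=1\}$; bars denote closures in the coefficient space. Continuous regularized dual function: $$J_{\nu,\lambda}(P,Q)=\frac1{\nu-1}\int_{\mathbb T^d}\frac{P^\nu}{Q^{\nu-1}}\,\mathrm d\mu+\langle\mathbf q,\mathbf c\rangle-\langle\mathbf p,\mathbf m\rangle+\frac{\lambda}{\nu-1}\int_{\mathbb T^d}\frac1{P^{\nu-1}}\,\mathrm d\mu\in(-\infty,+\infty],$$ with $\langle\mathbf q,\mathbf c\rangle=\sum_{\mathbf k\in\Lambda}q_{\mathbf k}c_{\mathbf k}$, $\langle\mathbf p,\mathbf m\rangle=\sum_{\mathbf k\in\Lambda}p_{\mathbf k}m_{\mathbf k}$, $p_{\mathbf 0}=1$, $m_{\mathbf 0}$ an arbitrary fixed real number; integrands are $[0,+\infty]$-valued with $a/0=+\infty$ for $a>0$ (values at points where $P=Q=0$ are irrelevant since the zero set of $P$ is null), so $J_{\nu,\lambda}(P,0)=+\infty$. Under the stated hypotheses its minimizer over $\overline{\mathfrak P}_{+,o}\times\overline{\mathfrak P}_+$ exists, is unique and lies in $\mathfrak P_{+,o}\times\mathfrak P_+$. Discrete problem: for $\mathbf N=(N_1,\dots,N_d)\in\mathbb N_+^d$, $|\mathbf N|=\prod_jN_j$, $\min(\mathbf N)=\min_jN_j$, the grid is $\mathbb T^d_{\mathbf N}=\{(\tfrac{2\pi}{N_1}\ell_1,\dots,\tfrac{2\pi}{N_d}\ell_d):0\le\ell_j\le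 N_j-1\}$ and $\mathrm d\eta_{\mathbf N}$ is the measure putting mass $1/|\mathbf N|$ at each grid point. $J^{\mathbf N}_{\nu,\lambda}$ is defined by the same formula as $J_{\nu,\lambda}$ with $\mathrm d\mu$ replaced by $\mathrm d\eta_{\mathbf N}$ (and the same data $\mathbf c,\mathbf m$, same $m_{\mathbf 0}$). *)

(* Defs.v *)
From HB Require Import structures.
From mathcomp Require Export all_boot all_order all_algebra finmap.
From mathcomp Require Export complex.
From mathcomp Require Export all_classical all_reals all_analysis.
From mathcomp Require Export measurable_realfun.

Set Implicit Arguments.
Unset Strict Implicit.
Unset Printing Implicit Defensive.

Export Order.TTheory GRing.Theory Num.Theory numFieldNormedType.Exports.

Local Open Scope classical_set_scope.
Local Open Scope ring_scope.

(* The alias gives R[i] the topology attached to the modulus: the library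
   declares it on abstract num(Closed)FieldTypes, not on R[i] itself. *)
Definition Cx (R : realType) : numClosedFieldType := R[i].

Section Torus.
Context {R : realType}.

Definition toC (x : R) : Cx R := x%:C%C.

(* e^{ix} *)
Definition expi (x : R) : Cx R := (cos x +i* sin x)%C.

Definition torus d : set 'rV[Cx R]_d := [set z | forall j, `|z ord0 j| = 1].

(* Points of T^d are tuples of angles in [0, 2 pi); functions on T^d are total
   functions on d.-tuple R of which only the values on Td matter. *)
Definition Td d : set (d.-tuple R) :=
  [set t | forall j, tnth t j \in `[0, 2 * pi[].

(* e^{it} = (e^{it_1}, ..., e^{it_d}), a bijection from Td to the torus *)
Definition expiv d (t : d.-tuple R) : 'rV[Cx R]_d := \row_j expi (tnth t j).

Definition pairing d (k : 'rV[int]_d) (t : d.-tuple R) : R :=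
  \sum_(j < d) (k ord0 j)%:~R * tnth t j.

Lemma twopi_gt0 : 0 < 2 * pi :> R.
Proof. by rewrite mulr_gt0// pi_gt0. Qed.

(* measurableTypeR R is R with its Borel sets, as uniform_prob expects it *)
Definition tcons d (x : measurableTypeR R * d.-tuple R) : d.+1.-tuple R :=
  [tuple of (x.1 : R) :: x.2].

Lemma measurable_tcons d : measurable_fun setT (@tcons d).
Proof.
by apply: measurable_cons; [exact: measurable_fst | exact: measurable_snd].
Qed.

HB.instance Definition _ d :=
  isMeasurableFun.Build _ _ _ _ (@tcons d) (@measurable_tcons d).

(* (2 pi)^-d dt_1 ... dt_d, as the d-fold product of dt / (2 pi) on [0, 2 pi];
   the endpoint 2 pi is a null set, and integrals are taken over Td. *)
Fixpoint mu d : probability (d.-tuple R) R :=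
  match d with
  | 0%N => \d_[tuple]
  | d'.+1 => distribution (uniform_prob twopi_gt0 \x mu d')%E (@tcons d')
  end.

End Torus.
Arguments torus {R} d.
Arguments Td {R} d _.
Arguments mu {R} d.

Section Grid.
Context {R : realType} {d : nat}.
Implicit Type N : 'I_d -> nat.

(* min_j N_j for d >= 1; the neutral value max_j N_j does not affect it *)
Definition minN N : nat := \big[minn/(\max_(j < d) N j)%N]_(j < d) N j.

Definition cardN N : nat := (\prod_(j < d) N j)%N.

Definition grid_pt N (l : {dffun forall j : 'I_d, 'I_(N j)}) : d.-tuple R :=
  [tuple 2 * pi / (N j)%:R * (l j)%:R | j < d].

Definition grid N : seq (d.-tuple R) :=
  [seq grid_pt l | l <- enum {dffun forall j : 'I_d, 'I_(N j)}].

(* mass 1 / |N| at each point of the grid *)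
Definition eta N : {measure set (d.-tuple R) -> \bar R} :=
  mscale ((cardN N)%:R^-1)%:nng
    (msum (fun i => \d_(nth [tuple 0 | j < d] (grid N) i)) (size (grid N))).

End Grid.

Section Dual.
Context {R : realType} {d : nat} {Lam : {fset 'rV[int]_d}}.
Implicit Types (p q c m : {ptws Lam -> R}) (t : d.-tuple R).

Definition Cintegral (F : d.-tuple R -> Cx R) : Cx R :=
  (\int[mu d]_(t in Td d) complex.Re (F t)
     +i* \int[mu d]_(t in Td d) complex.Im (F t))%C.

(* p_{-k} = p_k *)
Definition even_coef p := forall k l : Lam, val l = - val k -> p l = p k.

Definition trigC p t : Cx R :=
  \sum_(k : Lam) toC (p k) * expi (- pairing (val k) t).

(* The value of the polynomial at e^{it}; see trigC_real. *)
Definition trig p t : R := complex.Re (trigC p t).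

Definition dot p c : R := \sum_(k : Lam) p k * c k.

Definition Pplus : set {ptws Lam -> R} :=
  [set p | even_coef p /\ forall t, Td d t -> 0 < trig p t].

Definition normalized p := forall k : Lam, val k = 0 -> p k = 1.

Definition Pplus_o : set {ptws Lam -> R} := [set p | Pplus p /\ normalized p].

(* In \bar R, 0^-1 = +oo, a * +oo = +oo for a > 0, and 0 * +oo = 0. *)
Definition J (rho : {measure set (d.-tuple R) -> \bar R}) (nu : nat) (lam : R)
    c m p q : \bar R :=
  (((nu%:R - 1)^-1)%:E
     * \int[rho]_(t in Td d) ((trig p t ^+ nu)%:E / (trig q t ^+ nu.-1)%:E)
   + (dot q c)%:E - (dot p m)%:E
   + (lam / (nu%:R - 1))%:E
     * \int[rho]_(t in Td d) (1 / (trig p t ^+ nu.-1)%:E))%E.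

Definition is_solution (A : set ({ptws Lam -> R} * {ptws Lam -> R}))
    (F : {ptws Lam -> R} -> {ptws Lam -> R} -> \bar R) p q :=
  A (p, q) /\ forall p' q', A (p', q') -> (F p q <= F p' q')%E.

Definition continuous_feasible : set ({ptws Lam -> R} * {ptws Lam -> R}) :=
  [set pq | closure Pplus_o pq.1 /\ closure Pplus pq.2].

Definition discrete_feasible (N : 'I_d -> nat) :
    set ({ptws Lam -> R} * {ptws Lam -> R}) :=
  [set pq | [/\ even_coef pq.1, even_coef pq.2, normalized pq.1 &
    forall t, t \in grid N -> 0 < trig pq.1 t /\ 0 < trig pq.2 t]].

Definition Phi (nu : nat) p q t : R := (trig p t / trig q t) ^+ nu.

End Dual.
Arguments Pplus {R d} Lam.
Arguments Pplus_o {R d} Lam.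
Arguments continuous_feasible {R d} Lam.
Arguments discrete_feasible {R d} Lam N.

Section Facts.
Context {R : realType} {d : nat}.

Lemma sum_Re_Im (I : finType) (F : I -> Cx R) :
  \sum_i F i = ((\sum_i complex.Re (F i)) +i* (\sum_i complex.Im (F i)))%C.
Proof.
by elim/big_rec3 : _ => //= i x y z _ ->; case: (F i).
Qed.

Lemma trigE (Lam : {fset 'rV[int]_d}) (p : {ptws Lam -> R}) (t : d.-tuple R) :
  trig p t = \sum_(k : Lam) p k * cos (pairing (val k) t).
Proof.
rewrite /trig /trigC sum_Re_Im /=; apply: eq_bigr => k _.
by rewrite mul0r subr0 cosN.
Qed.

Lemma pairingN (k : 'rV[int]_d) (t : d.-tuple R) : pairing (- k) t = - pairing k t.
Proof.
by rewrite /pairing -sumrN; apply: eq_bigr => j _; rewrite mxE mulrNz mulNr.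
Qed.

Lemma trigC_real (Lam : {fset 'rV[int]_d}) (p : {ptws Lam -> R}) (t : d.-tuple R) :
  (forall k, k \in Lam -> - k \in Lam) -> even_coef p ->
  trigC p t = toC (trig p t).
Proof.
move=> Lsym pe; rewrite /trig {2}/trigC sum_Re_Im /trigC sum_Re_Im /toC /=.
congr (_ +i* _)%C.
pose h (k : Lam) : Lam := [` Lsym _ (valP k)]%fset.
have hK : involutive h by move=> k; apply: val_inj; rewrite /= opprK.
set S := LHS; suff /eqP : S = - S by rewrite -addr_eq0 -mulr2n mulrn_eq0 /= => /eqP.
rewrite [LHS](reindex_inj (inv_inj hK)) /= /S -sumrN; apply: eq_bigr => k _.
have -> : p (h k) = p k by apply/esym/pe; rewrite /= opprK.
by rewrite !mul0r !addr0 pairingN !sinN mulrN.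
Qed.

Lemma size_grid (N : 'I_d -> nat) : size (@grid R d N) = cardN N.
Proof.
rewrite size_map -cardE card_dep_ffun /= foldrE big_map big_enum /=.
by apply: eq_bigr => j _; rewrite card_ord.
Qed.

Lemma grid_Td (N : 'I_d -> nat) t : t \in @grid R d N -> Td d t.
Proof.
move=> /mapP[l _ ->] j; rewrite tnth_mktuple.
have N0 : (0 < N j)%N by exact: leq_ltn_trans (ltn_ord (l j)).
rewrite in_itv /= -mulrA mulr_ge0 ?(ltW twopi_gt0)//=.
rewrite gtr_pMr ?twopi_gt0// mulrC ltr_pdivrMr ?ltr0n// mul1r ltr_nat.
exact: ltn_ord.
Qed.

Lemma measurable_Td : measurable (@Td R d).
Proof.
rewrite (_ : @Td R d = \bigcap_(j in [set: 'I_d])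
  (fun t => tnth t j) @^-1` `[0, 2 * pi[%classic).
  apply: fin_bigcap_measurable => // j _.
  rewrite -[X in measurable X]setTI.
  by apply: measurable_tnth => //; exact: measurable_itv.
by apply/seteqP; split=> t /= h j; [move=> _|]; exact: h.
Qed.

Lemma integral_eta (N : 'I_d -> nat) (f : d.-tuple R -> \bar R) :
  measurable_fun (Td d) f -> (forall t, Td d t -> 0 <= f t)%E ->
  (\int[eta N]_(t in Td d) f t = ((cardN N)%:R^-1)%:E * \sum_(t <- grid N) f t)%E.
Proof.
move=> mf f0; have mT := measurable_Td.
rewrite ge0_integral_mscale//; congr (_ * _)%E.
rewrite ge0_integral_measure_sum//.
rewrite (big_nth [tuple 0 | j < d]) big_mkord; apply: eq_bigr => i _.
rewrite integral_dirac// diracE mem_set ?mul1e//.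
by apply: (@grid_Td N); exact: mem_nth.
Qed.
End Facts.

(* Main.v *)
From mathcomp Require Import ring lra.
Require Import Defs.

(** The continuous minimizer [(phat, qhat)] is strictly positive: a nonnegative
    trigonometric polynomial vanishes to second order at a zero, so that
    [1 / P ^ (nu - 1)] is not integrable there as soon as [2 (nu - 1) >= d]
    ([nonintegrable_quot]), while the minimum is finite. A zero of [phat], then one
    of [qhat], is thus excluded ([hat_feasible]).

    The two integrands of the dual function are perspectives of a power, hence convex.
    The one of the regularizing term is strictly convex in [P], and the leading one is
    strictly convex in [Q] once [P] is fixed; together with the independence of
    characters this shows that no other pair of positive polynomials attains the
    minimum ([minimizer_unique]).

    Averages over grids of mesh tending to 0 are Riemann sums of [mu], so near a pair of
    positive polynomials the discrete dual functions tend to the continuous one locally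
    uniformly ([Jr_joint]). Hence on every small sphere around [(phat, qhat)] the
    discrete functions eventually exceed their value at the centre ([near_sphere]).
    As they are convex and their minimizers do at least as well as the centre, these
    minimizers lie inside the sphere ([dist_le_near]). The coefficients therefore
    converge, the ratios [pN / qN] converge uniformly on the torus, and integrating them
    against a continuous function over the grid gives the integral of the limit in the
    limit ([spectrum_cvg]). The whole sequence converges, so the identity is a valid
    extraction. *)

Set Implicit Arguments.
Unset Strict Implicit.
Unset Printing Implicit Defensive.

Local Open Scope classical_set_scope.
Local Open Scope ring_scope.

(** * The perspective of a power function *)

Section Perspective.
Context {R : realFieldType}.
Implicit Types (a b u r : R) (k : nat).

(** The perspective of [u ^+ k.+1]. Both integrands of the dual function have
    this form: [P ^ nu / Q ^ (nu - 1)] is [persp k P Q] with [nu = k.+1], and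
    [1 / P ^ (nu - 1)] is [persp k 1 P]. *)
Definition persp k a b : R := a ^+ k.+1 / b ^+ k.

(** A power lies above its tangent at [r]: the gap of exponent [k.+2] is [u] times
    the gap of exponent [k.+1] plus a nonnegative multiple of [(u - r) ^+ 2]. *)
Lemma pow_tangent k u r : 0 <= u -> 0 <= r ->
  k.+1%:R * r ^+ k * u - k%:R * r ^+ k.+1 <= u ^+ k.+1.
Proof.
move=> u0 r0; elim: k => [|k IH]; first by rewrite expr0 !mul1r mul0r subr0.
rewrite [leRHS]exprS; apply: le_trans (ler_wpM2l u0 IH).
rewrite -subr_ge0 [X in 0 <= X](_ : _ = k.+1%:R * (r ^+ k * (u - r) ^+ 2)).
  exact: mulr_ge0 (ler0n _ _) (mulr_ge0 (exprn_ge0 _ r0) (sqr_ge0 _)).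
by rewrite !exprS -!(natr1 k.+1) -!(natr1 k); ring.
Qed.

(** The multiple of [(u - r) ^+ 2] picked up in the last step of the induction for
    [pow_tangent] already forces [u = r] when the tangent is attained. *)
Lemma pow_tangent_eq k u r : (0 < k)%N -> 0 <= u -> 0 < r ->
  k.+1%:R * r ^+ k * u - k%:R * r ^+ k.+1 = u ^+ k.+1 -> u = r.
Proof.
case: k => // k _ u0 r0 E; apply/eqP; rewrite -subr_eq0 -sqrf_eq0.
have := ler_wpM2l u0 (pow_tangent k u0 (ltW r0)).
rewrite -exprS -E -subr_le0 [X in X <= 0](_ : _ = k.+1%:R * (r ^+ k * (u - r) ^+ 2)).
  rewrite pmulr_rle0 ?ltr0n// pmulr_rle0 ?exprn_gt0// => h.
  by rewrite eq_le h sqr_ge0.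
by rewrite !exprS -!(natr1 k.+1) -!(natr1 k); ring.
Qed.

Lemma perspE k a b : 0 < b -> persp k a b = (a / b) ^+ k.+1 * b.
Proof.
by move=> b0; rewrite /persp expr_div_n (exprSr b) invfM mulrA -[RHS]mulrA mulVf ?mulr1 ?gt_eqF.
Qed.

(** The plane tangent to [persp k] along the whole ray [a = r * b], since [persp k]
    is homogeneous of degree 1. *)
Definition persp_plane k r a b := k.+1%:R * r ^+ k * a - k%:R * r ^+ k.+1 * b.

Lemma persp_planeE k r a b : 0 < b ->
  persp_plane k r a b = (k.+1%:R * r ^+ k * (a / b) - k%:R * r ^+ k.+1) * b.
Proof.
by move=> b0; rewrite /persp_plane mulrBl -[_ * (a / b) * b]mulrA divfK ?gt_eqF.
Qed.

Lemma persp_tangent k a b r : 0 <= a -> 0 < b -> 0 <= r ->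
  persp_plane k r a b <= persp k a b.
Proof.
move=> a0 b0 r0; rewrite perspE// persp_planeE// ler_pM2r//.
by apply: pow_tangent => //; rewrite divr_ge0 // ltW.
Qed.

Lemma persp_tangent_eq k a b r : (0 < k)%N -> 0 <= a -> 0 < b -> 0 < r ->
  persp k a b <= persp_plane k r a b -> a = r * b.
Proof.
move=> k0 a0 b0 r0 h.
suff <- : a / b = r by rewrite divfK ?gt_eqF.
have ab0 : 0 <= a / b by rewrite divr_ge0 // ltW.
apply: (@pow_tangent_eq k) => //; apply/eqP.
rewrite eq_le (pow_tangent _ ab0 (ltW r0)) andTb.
by rewrite -(ler_pM2r b0) -persp_planeE // -perspE.
Qed.

Lemma persp_plane_id k a b : 0 < b -> persp_plane k (a / b) a b = persp k a b.
Proof.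
move=> b0; rewrite perspE// persp_planeE//; congr (_ * _).
by rewrite -mulrA -exprSr -mulrBl -natr1 addrAC subrr add0r mul1r.
Qed.

(** Compare with the tangent plane at the intermediate point: it lies below [persp k]
    at both endpoints and is affine. *)
Lemma persp_convex k (s a0 b0 a1 b1 : R) : 0 <= s <= 1 ->
  0 < a0 -> 0 < b0 -> 0 < a1 -> 0 < b1 ->
  persp k (a0 + s * (a1 - a0)) (b0 + s * (b1 - b0)) <=
  persp k a0 b0 + s * (persp k a1 b1 - persp k a0 b0).
Proof.
move=> /andP[s0 s1] a00 b00 a10 b10.
have pos x y : 0 < x -> 0 < y -> 0 < x + s * (y - x).
  move=> x0 y0; have [->|sN] := eqVneq s 1; first by rewrite mul1r addrC subrK.
  have : 0 < (1 - s) * x by rewrite mulr_gt0// subr_gt0 lt_neqAle sN.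
  by have : 0 <= s * y by [rewrite mulr_ge0// ltW]; lra.
set a := a0 + _; set b := b0 + _.
have a_0 : 0 < a by exact: pos.
have b_0 : 0 < b by exact: pos.
rewrite -(persp_plane_id _ _ b_0); set r := a / b.
have r0 : 0 <= r by rewrite divr_ge0// ltW.
have h0 := persp_tangent k (ltW a00) b00 r0.
have h1 := persp_tangent k (ltW a10) b10 r0.
have -> : persp_plane k r a b =
    (1 - s) * persp_plane k r a0 b0 + s * persp_plane k r a1 b1.
  by rewrite /persp_plane /a /b; ring.
have : 0 <= 1 - s by rewrite subr_ge0.
move=> s1'; have := ler_wpM2l s0 h1; have := ler_wpM2l s1' h0.
by move=> ? ?; lra.
Qed.

(** Homogeneity makes [persp k] affine on each ray from the origin, so strict
    convexity can only be claimed across rays: equality at the midpoint puts both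
    endpoints on the tangency ray of the midpoint. *)
Lemma persp_midpoint_eq k (a0 b0 a1 b1 : R) : (0 < k)%N ->
  0 < a0 -> 0 < b0 -> 0 < a1 -> 0 < b1 ->
  persp k a0 b0 + persp k a1 b1 <=
    persp k ((a0 + a1) / 2) ((b0 + b1) / 2) *+ 2 ->
  a0 * b1 = a1 * b0.
Proof.
move=> k0 a00 b00 a10 b10.
set a := (a0 + _) / _; set b := (b0 + _) / _.
have a_0 : 0 < a by rewrite /a; lra.
have b_0 : 0 < b by rewrite /b; lra.
rewrite -(persp_plane_id _ _ b_0); set r := a / b.
have r0 : 0 < r by rewrite divr_gt0.
have h0 := persp_tangent k (ltW a00) b00 (ltW r0).
have h1 := persp_tangent k (ltW a10) b10 (ltW r0).
have -> : persp_plane k r a b *+ 2 = persp_plane k r a0 b0 + persp_plane k r a1 b1.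
  by rewrite /persp_plane /a /b mulr2n; field.
move=> h.
have -> : a0 = r * b0 by apply: (persp_tangent_eq k0) => //; [exact: ltW|lra].
have -> : a1 = r * b1 by apply: (persp_tangent_eq k0) => //; [exact: ltW|lra].
by ring.
Qed.

End Perspective.

(** * Trigonometric polynomials *)

Section TrigPolynomials.
Context {R : realType} {d : nat}.
Implicit Types (t h : d.-tuple R) (k : 'rV[int]_d).

Definition tadd t h : d.-tuple R := [tuple tnth t j + tnth h j | j < d].

Lemma pairing_tadd k t h : pairing k (tadd t h) = pairing k t + pairing k h.
Proof.
rewrite /pairing -big_split; apply: eq_bigr => j _.
by rewrite tnth_mktuple mulrDr.
Qed.

Lemma cosD2piz (x : R) (z : int) : cos (x + z%:~R * (2 * pi)) = cos x.
Proof.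
have E (y : R) n : cos (y + n%:R * (2 * pi)) = cos y.
  by rewrite mulr_natl mulr_natl; apply: (periodicn (@cosD2pi R)).
case: z => n; first exact: E.
by rewrite NegzE mulrNz mulNr -(E (x - _) n.+1) subrK.
Qed.

(** By periodicity, whatever is known of the values of a polynomial on [Td d] holds
    at every tuple of angles; this allows shifting arguments freely. *)
Lemma Td_repr t : exists2 t', Td d t' &
  forall (Lam : {fset 'rV[int]_d}) (p : {ptws Lam -> R}), trig p t' = trig p t.
Proof.
have pi2 : 0 < 2 * pi :> R := twopi_gt0.
pose z (j : 'I_d) : int := Num.floor (tnth t j / (2 * pi)).
exists [tuple tnth t j - (z j)%:~R * (2 * pi) | j < d].
  move=> j; rewrite tnth_mktuple in_itv /=.
  have /andP[z1 z2] := floor_itv (tnth t j / (2 * pi)); rewrite -/(z j) in z1 z2.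
  rewrite subr_ge0 -ler_pdivlMr// z1/= ltrBlDr -{1}(mul1r (2 * pi)) -mulrDl.
  by rewrite -ltr_pdivrMr// addrC -[1]/(1%:~R) -intrD.
move=> Lam p; rewrite !trigE; apply: eq_bigr => k _; congr (_ * _).
rewrite -(cosD2piz (pairing (val k) t) (- \sum_j (val k) ord0 j * z j)).
congr cos; rewrite /pairing mulrNz mulNr rmorph_sum/= mulr_suml -sumrB.
by apply: eq_bigr => j _; rewrite tnth_mktuple mulrBr intrM mulrA.
Qed.

Lemma sin_le_norm (x : R) : `|sin x| <= `|x|.
Proof.
wlog x0 : x / 0 <= x => [h|].
  have [x0|x0] := leP 0 x; first exact: h.
  by rewrite -[sin x]opprK -sinN normrN -[leRHS]normrN; apply: h; rewrite oppr_ge0 ltW.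
have [c _] := @MVT_segment R sin cos 0 x x0
  (fun y _ => is_derive_sin y) (continuous_subspaceT (@continuous_sin R)).
by rewrite sin0 !subr0 => ->; rewrite normrM ler_piMl// cos_max.
Qed.

Lemma onem_cos_le (x : R) : 0 <= 1 - cos x <= x ^+ 2.
Proof.
rewrite subr_ge0 cos_le1/=.
have -> : x = (x / 2) *+ 2 by rewrite mulr2n -splitr.
set y := x / 2.
have h : sin y ^+ 2 <= y ^+ 2.
  by rewrite -(real_normK (num_real (sin y))) -(real_normK (num_real y)) ler_sqr ?nnegrE// sin_le_norm.
rewrite cos_mulr2n cos2sin2 (_ : (y *+ 2) ^+ 2 = y ^+ 2 *+ 4); last by ring.
rewrite (_ : 1 - _ = sin y ^+ 2 *+ 2); last by ring.
apply: (@le_trans _ _ (y ^+ 2 *+ 2)); first by rewrite lerMn2r.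
by rewrite ler_wpMn2l// sqr_ge0.
Qed.

(** A nonnegative polynomial vanishes to second order at its zeros. Adding the
    nonnegative value at [t0 - h] cancels the odd part in [h], and what remains is
    [-2 sum_k p_k cos(<k,t0>) (1 - cos(<k,h>))]. *)
Lemma trig_zero_bound (Lam : {fset 'rV[int]_d}) (p : {ptws Lam -> R}) t0 h :
  (forall t, 0 <= trig p t) -> trig p t0 = 0 ->
  trig p (tadd t0 h) <= \sum_(k : Lam) 2 * `|p k| * pairing (val k) h ^+ 2.
Proof.
move=> p0 pt0.
pose h' : d.-tuple R := [tuple - tnth h j | j < d].
have ph' k : pairing k h' = - pairing k h.
  by rewrite /pairing -sumrN; apply: eq_bigr => j _; rewrite tnth_mktuple mulrN.
apply: (@le_trans _ _ (trig p (tadd t0 h) + trig p (tadd t0 h') - 2 * trig p t0)).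
  by rewrite pt0 mulr0 subr0 lerDl.
rewrite !trigE mulr_sumr -big_split -sumrB/=; apply: ler_sum => k _.
rewrite !pairing_tadd ph' cosB cosD.
set c := cos (pairing _ t0); set c' := cos (pairing _ h).
have -> : p k * (c * c' - sin (pairing (val k) t0) * sin (pairing (val k) h)) +
   p k * (c * c' + sin (pairing (val k) t0) * sin (pairing (val k) h))
    - 2 * (p k * c) = - 2 * (p k * c) * (1 - c') by ring.
have /andP[c'0 c'1] := onem_cos_le (pairing (val k) h).
apply: (@le_trans _ _ (2 * `|p k| * (1 - c'))).
  apply: ler_wpM2r => //; rewrite mulNr -mulrN; apply: ler_wpM2l => //.
  by rewrite (le_trans (ler_norm _))// normrN normrM ler_piMr// cos_max.
by rewrite ler_wpM2l// mulr_ge0.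
Qed.

Lemma expiD (x y : R) : expi (x + y) = expi x * expi y.
Proof.
by rewrite /expi cosD sinD; apply/eqP; rewrite eq_complex/= addrC addrC eqxx/= addrC eqxx.
Qed.

Lemma expi_pi : expi (pi : R) = -1.
Proof. by rewrite /expi cospi sinpi; apply/eqP; rewrite eq_complex/= oppr0 !eqxx. Qed.

(** Dedekind's argument for the independence of characters, one frequency at a time.
    To remove [l] from a vanishing combination, take a shift [s] with
    [<k0,s> = <l,s> + pi] and add to the relation its translate by [s], normalised
    by [e^(i<k0,s>)]: the coefficient at [k] gets the factor
    [1 + e^(i<k0 - k,s>)], which is 0 at [l] and 2 at [k0]. *)
Lemma character_elimination (Lam : {fset 'rV[int]_d}) (k0 : Lam) (s : seq Lam) (c : Lam -> Cx R) :
  k0 \notin s ->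
  (forall t, \sum_k c k * expi (- pairing (val k) t) = 0) ->
  exists c' : Lam -> Cx R,
    [/\ forall t, \sum_k c' k * expi (- pairing (val k) t) = 0,
        c' k0 = c k0 * 2 ^+ size s & forall l, l \in s -> c' l = 0].
Proof.
elim: s => [_ h|l s IH]; first by exists c; split=> //; rewrite expr0 mulr1.
rewrite in_cons negb_or => /andP[lk0 k0s] h.
have [c' [h1 h2 h3]] := IH k0s h.
(* a coordinate separating the two frequencies carries the whole shift *)
have [j jl] : exists j, val k0 ord0 j != val l ord0 j.
  apply/existsP; apply: contraNT lk0 => /existsPn/= e; apply/eqP/val_inj/rowP => j.
  by apply/eqP; rewrite -[_ == _]negbK.
pose s0 : d.-tuple R :=
  [tuple if i == j then pi / (val k0 ord0 j - val l ord0 j)%:~R else 0 | i < d].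
have ps0 k : pairing k s0 = (k ord0 j)%:~R * (pi / (val k0 ord0 j - val l ord0 j)%:~R).
  rewrite /pairing (bigD1 j)//= tnth_mktuple eqxx big1 ?addr0// => i ij.
  by rewrite tnth_mktuple (negbTE ij) mulr0.
have ls0 : pairing (val k0) s0 = pairing (val l) s0 + pi.
  rewrite !ps0; apply/eqP; rewrite -subr_eq0 opprD addrA subr_eq0 -mulrBl -intrB mulrCA divff ?mulr1//.
  by rewrite intr_eq0 subr_eq0.
exists (fun k : Lam => c' k * (1 + expi (pairing (val k0) s0 - pairing (val k) s0))).
split=> [t||m].
- under eq_bigr => k _.
    rewrite (_ : _ * _ * _ = c' k * expi (- pairing (val k) t) +
       expi (pairing (val k0) s0) * (c' k * expi (- pairing (val k) (tadd t s0)))); last first.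
      rewrite pairing_tadd opprD !expiD; ring.
    over.
  by rewrite big_split/= -mulr_sumr !h1 mulr0 addr0.
- rewrite subrr h2 /= exprSr mulrA; congr (_ * _).
  by rewrite /expi cos0 sin0 -[(1 +i* 0)%C]/(1 : Cx R) -natr1.
- rewrite in_cons => /orP[/eqP->|/h3->]; last by rewrite mul0r.
  by rewrite ls0 [_ + pi]addrC addrK expi_pi subrr mulr0.
Qed.

(** Evenness makes the complex polynomial equal to its real part, to which
    [character_elimination] applies with every frequency other than [k0] removed. *)
Lemma trig_eq0 (Lam : {fset 'rV[int]_d}) (p : {ptws Lam -> R}) :
  (forall k, k \in Lam -> - k \in Lam) -> even_coef p ->
  (forall t, trig p t = 0) -> forall k : Lam, p k = 0.
Proof.
move=> Lsym pe p0 k0.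
have h t : \sum_(k : Lam) toC (p k) * expi (- pairing (val k) t) = 0.
  by have := trigC_real t Lsym pe; rewrite p0 /trigC => ->.
have [|c' [h1 h2 h3]] :=
  character_elimination (k0 := k0) (s := [seq k <- enum {: Lam} | k != k0]) _ h.
  by rewrite mem_filter eqxx.
have := h1 [tuple 0 | j < d].
rewrite (bigD1 k0)//= big1 ?addr0 => [|k kk0]; last first.
  by rewrite h3 ?mul0r// mem_filter kk0 mem_enum.
rewrite (_ : pairing _ _ = 0); last first.
  by rewrite /pairing big1// => j _; rewrite tnth_mktuple mulr0.
rewrite oppr0 /expi cos0 sin0 -[(1 +i* 0)%C]/(1 : Cx R) mulr1 h2 => /eqP.
rewrite mulf_eq0 expf_eq0 pnatr_eq0 andbF orbF => /eqP.
by case.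
Qed.

End TrigPolynomials.

(** * Boxes, grid cells and step functions *)

Section Boxes.
Context {R : realType}.

Definition box d (a b : 'I_d -> R) : set (d.-tuple R) :=
  [set t | forall j, tnth t j \in `[a j, b j[].

Lemma measurable_box d (a b : 'I_d -> R) : measurable (box a b).
Proof.
rewrite (_ : box a b = \bigcap_(j in [set: 'I_d])
  (fun t => tnth t j) @^-1` `[a j, b j[%classic).
  apply: fin_bigcap_measurable => // j _.
  rewrite -[X in measurable X]setTI.
  by apply: measurable_tnth => //; exact: measurable_itv.
by apply/seteqP; split=> t /= h j; [move=> _|]; exact: h.
Qed.

Lemma uniform_prob_itv (a b : R) : 0 <= a -> a <= b -> b <= 2 * pi ->
  uniform_prob (@twopi_gt0 R) `[a, b[%classic = ((b - a) / (2 * pi))%:E.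
Proof.
move=> a0 ab b2; rewrite /uniform_prob.
rewrite (eq_integral (fun=> (2 * pi)^-1%:E)); last first.
  move=> x; rewrite inE/= in_itv/= => /andP[ax xb].
  by rewrite /uniform_pdf subr0 (le_trans a0 ax) (le_trans (ltW xb) b2).
rewrite integral_cst//= lebesgue_measure_itv/= lte_fin.
case: ltgtP ab => // [ab _|-> _]; first by rewrite -EFinD -EFinM mulrC.
by rewrite mule0 subrr mul0r.
Qed.

(** By induction on the dimension, as [mu d.+1] is the image of a product measure. *)
Lemma mu_box d (a b : 'I_d -> R) :
  (forall j, [/\ 0 <= a j, a j <= b j & b j <= 2 * pi]) ->
  mu d (box a b) = (\prod_(j < d) ((b j - a j) / (2 * pi)))%:E.
Proof.
elim: d a b => [a b _|d IH a b ab].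
  rewrite big_ord0 /= diracE mem_set// => -[].
  by case.
rewrite big_ord_recl EFinM -uniform_prob_itv; [|by have [] := ab ord0|by have [] := ab ord0|by have [] := ab ord0].
rewrite -(IH (a \o lift ord0) (b \o lift ord0)); last by move=> j; exact: ab.
rewrite [LHS]/= /distribution /pushforward/=.
rewrite -product_measure1E//; last exact: measurable_box.
congr product_measure1; apply/seteqP; split => [[x t]|[x t]] /=.
  move=> h; split; first exact: (h ord0).
  by move=> j; have := h (lift ord0 j); rewrite tnthS.
move=> [h1 h2] j; have [->|[i ->]] : j = ord0 \/ exists i, j = lift ord0 i.
- by case: (unliftP ord0 j) => [i ->|->]; [right; exists i|left].
- exact: h1.
- by rewrite tnthS; exact: h2.
Qed.

End Boxes.

Section Cells.
Context {R : realType} {d : nat} (N : 'I_d -> nat).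
Hypothesis N0 : forall j, (0 < N j)%N.
Implicit Types (l : {dffun forall j : 'I_d, 'I_(N j)}) (F : d.-tuple R -> R).

Definition mean F : R := (cardN N)%:R^-1 * \sum_(t <- grid N) F t.

(** The cells tile [Td d], each grid point being the lower corner of its cell, and
    they all have the mass [1 / |N|] that [eta N] gives to a grid point. *)
Definition cell l : set (d.-tuple R) :=
  box (fun j => 2 * pi / (N j)%:R * (l j)%:R) (fun j => 2 * pi / (N j)%:R * (l j).+1%:R).

Lemma mu_cell l : mu d (cell l) = ((cardN N)%:R^-1)%:E.
Proof.
rewrite mu_box => [|j].
  congr EFin; rewrite /cardN natr_prod -prodfV; apply: eq_bigr => j _.
  rewrite -mulrBr -natrB// subSnn mulr1 -mulrA mulrCA divff ?mulr1//.
  by rewrite gt_eqF ?twopi_gt0.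
have h : 0 <= 2 * pi / (N j)%:R :> R by rewrite divr_ge0// ltW// twopi_gt0.
split; first by rewrite mulr_ge0.
  by rewrite ler_wpM2l// ler_nat.
by rewrite -mulrA ler_piMr ?(ltW twopi_gt0)// mulrC ler_pdivrMr ?ltr0n// mul1r ler_nat.
Qed.

Let c_gt0 j : 0 < 2 * pi / (N j)%:R :> R.
Proof. by rewrite divr_gt0 ?twopi_gt0 ?ltr0n. Qed.

Lemma in_cell l t : Td d t ->
  cell l t <-> forall j, Num.truncn (tnth t j / (2 * pi / (N j)%:R)) = l j.
Proof.
move=> tT.
have E j : (tnth t j \in `[2 * pi / (N j)%:R * (l j)%:R, 2 * pi / (N j)%:R * (l j).+1%:R[) =
   (Num.truncn (tnth t j / (2 * pi / (N j)%:R)) == l j :> nat).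
  rewrite truncn_eq; last first.
    by rewrite divr_ge0// ?(ltW (c_gt0 j))//; have := tT j; rewrite in_itv/= => /andP[].
  by rewrite ler_pdivlMr// ltr_pdivrMr// in_itv/= ![_ * (2 * pi / _)]mulrC.
by split => h j; [apply/eqP; rewrite -E; exact: h|rewrite E; apply/eqP; exact: h].
Qed.

Lemma ex_cell t : Td d t -> exists l, cell l t.
Proof.
move=> tT.
have lt j : (Num.truncn (tnth t j / (2 * pi / (N j)%:R)) < N j)%N.
  have /andP[t0 t1] : 0 <= tnth t j < 2 * pi by have := tT j; rewrite in_itv.
  rewrite truncn_lt_nat; last by rewrite divr_ge0// (ltW (c_gt0 j)).
  rewrite ltr_pdivrMr; last exact: c_gt0.
  by rewrite mulrCA divff ?mulr1// pnatr_eq0 -lt0n.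
exists [ffun j => Ordinal (lt j)]; apply/in_cell => // j.
by rewrite ffunE.
Qed.

Lemma cell_uniq l l' t : Td d t -> cell l t -> cell l' t -> l = l'.
Proof.
move=> tT /in_cell-/(_ tT) h /in_cell-/(_ tT) h'.
by apply/ffunP => j; apply/val_inj; rewrite /= -h -h'.
Qed.

Lemma cell_sub_Td l : cell l `<=` Td d.
Proof.
move=> t h j; have := h j; rewrite !in_itv/= => /andP[h1 h2]; apply/andP; split.
  by rewrite (le_trans _ h1)// mulr_ge0// ltW.
rewrite (lt_le_trans h2)// -mulrA ler_piMr ?(ltW twopi_gt0)// mulrC.
by rewrite ler_pdivrMr ?ltr0n// mul1r ler_nat.
Qed.

Lemma cell_grid_pt l t : cell l t ->
  forall j, 0 <= tnth t j - tnth (grid_pt l) j <= 2 * pi / (N j)%:R.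
Proof.
move=> h j; have := h j; rewrite in_itv/= => /andP[h1 h2].
rewrite tnth_mktuple subr_ge0 h1/= lerBlDl -[X in _ <= _ + X]mulr1 -mulrDr natr1.
exact: ltW.
Qed.

(** The function constant on each cell with the value of [F] at the grid point of
    the cell; its integral is a Riemann sum of [F]. *)
Definition step F t : R := \sum_l F (grid_pt l) * \1_(cell l) t.

Lemma step_cell F l t : Td d t -> cell l t -> step F t = F (grid_pt l).
Proof.
move=> tT tl; rewrite /step (bigD1 l)//= indicE mem_set// mulr1 big1 ?addr0// => l' l'l.
rewrite indicE memNset ?mulr0// => tl'; case/negP: l'l.
by apply/eqP; exact: (cell_uniq tT).
Qed.

Lemma measurable_step D F : measurable_fun D (step F).
Proof.
apply: measurable_sum => l; apply: measurable_funM => //.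
by apply: measurable_indic; exact: measurable_box.
Qed.

Lemma integral_step F :
  (\int[mu d]_(t in Td d) (step F t)%:E = (mean F)%:E)%E.
Proof.
have mc l : measurable (cell l) by exact: measurable_box.
rewrite (eq_integral (fun t => \sum_l (F (grid_pt l))%:E * (\1_(cell l) t)%:E))%E;
  last by move=> t _; rewrite /step -sumEFin; apply: eq_bigr => l _; rewrite EFinM.
rewrite integral_sum//=; last 2 first.
- exact: measurable_Td.
- move=> l; apply: integrableZl => //; first exact: measurable_Td.
  apply: integrableS (integrable_indic _ (mc l)) => //; exact: measurable_Td.
rewrite /mean /grid big_map big_enum/= mulr_sumr -sumEFin; apply: eq_bigr => l _.
rewrite integralZl//; last 2 first.
  exact: measurable_Td.
  by apply: integrableS (integrable_indic _ (mc l)) => //; exact: measurable_Td.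
rewrite integral_indic//; last exact: measurable_Td.
rewrite setIidl; last exact: cell_sub_Td.
by rewrite EFinM [RHS]muleC; congr (_ * _)%E; exact: mu_cell.
Qed.

End Cells.

(** * Riemann sums of continuous functions *)

Section PointwiseConvergence.

Lemma ptws_cvg (U : choiceType) (V : topologicalType) (T : Type)
    (F : set_system T) (g : T -> U -> V) (f : U -> V) :
  Filter F -> (forall u, g x u @[x --> F] --> f u) ->
  (g : T -> {ptws U -> V}) @ F --> (f : {ptws U -> V}).
Proof.
move=> FF h; apply/cvg_sup => i; apply/cvg_image.
  by rewrite eqEsubset; split=> v // _; exists (cst v).
move=> W /h /= Wh; exists (@^~ i @^-1` W) => //.
by rewrite eqEsubset; split => [j [? + <-//]|j Wj]; exists (fun _ => j).
Qed.

End PointwiseConvergence.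

Section RiemannSums.
Context {R : realType} {d : nat}.
Implicit Types (F G : d.-tuple R -> R).

(** Parametrization of angles by functions under pointwise convergence, through
    which continuity of functions of a tuple is expressed. *)
Definition tup (a : {ptws 'I_d -> R}) : d.-tuple R := [tuple a j | j < d].

Lemma tupK (t : d.-tuple R) : tup (tnth t) = t.
Proof. by apply: eq_from_tnth => j; rewrite tnth_mktuple. Qed.

Definition cube : set {ptws 'I_d -> R} := [set a | forall j, `[0, 2 * pi]%classic (a j)].

Lemma compact_cube : compact cube.
Proof.
exact: (@tychonoff 'I_d (fun=> R) (fun=> `[0, 2 * pi]%classic)
  (fun=> @segment_compact R _ _)).
Qed.

Lemma Td_cube (t : d.-tuple R) : Td d t -> cube (tnth t).
Proof.
by move=> h j; have := h j; rewrite /= !in_itv/= => /andP[-> /ltW].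
Qed.

Lemma minN_le (N : 'I_d -> nat) j : (minN N <= N j)%N.
Proof.
rewrite /minN; move: (\max_(_ < _) _)%N => x.
have := mem_index_enum j; elim: (index_enum _) => // i s IH.
rewrite in_cons big_cons => /orP[/eqP<-|/IH h]; first exact: geq_minl.
exact: leq_trans (geq_minr _ _) h.
Qed.

Lemma mesh_cvg (N : nat -> 'I_d -> nat) j : minN (N n) @[n --> \oo] --> \oo ->
  2 * pi / (N n j)%:R @[n --> \oo] --> (0 : R).
Proof.
move=> h; rewrite -[X in _ --> X](mulr0 (2 * pi : R)).
apply: cvgMr; apply: (proj2 (gtr0_cvgV0 (f := fun n => (N n j)%:R) _)); last first.
  apply/cvgryPge => M; move/cvgnyPge : h => /(_ (Num.truncn M).+1).
  apply: filterS => n h; rewrite (le_trans (ltW (truncnS_gt M)))//.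
  by rewrite ler_nat (leq_trans h)// minN_le.
move/cvgnyPge : h => /(_ 1%N); apply: filterS => n h.
by rewrite ltr0n (leq_trans h)// minN_le.
Qed.

Lemma bounded_on_Td F : continuous (F \o tup) -> exists M, forall t, Td d t -> `|F t| <= M.
Proof.
move=> Fc.
have /compact_bounded[M [_ hM]] :=
  continuous_compact (continuous_subspaceT Fc) compact_cube.
exists (M + 1) => t tT; apply: (hM (M + 1)); first by rewrite ltrDl.
by exists (tnth t); [exact: Td_cube|rewrite /= tupK].
Qed.

Lemma mean_dist (N : 'I_d -> nat) F G e : (forall j, (0 < N j)%N) ->
  (forall t, Td d t -> `|F t - G t| <= e) -> `|mean N F - mean N G| <= e.
Proof.
move=> N0 h; have N0' : 0 < (cardN N)%:R :> R by rewrite ltr0n prodn_gt0.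
rewrite /mean -mulrBr -sumrB normrM gtr0_norm ?invr_gt0// mulrC ler_pdivrMr//.
apply: le_trans (ler_norm_sum _ _ _) _.
apply: (@le_trans _ _ (\sum_(t <- @grid R d N) e)).
  rewrite /grid !big_map; apply: ler_sum => l _; apply: h.
  by apply: (@grid_Td _ _ N); rewrite map_f// mem_enum.
by rewrite big_const_seq count_predT iter_addr addr0 size_grid mulr_natr.
Qed.

(** The grid point of the cell of [t] is within [2 pi / N_j] of [t] in each
    coordinate [j]. *)
Lemma step_cvg (N : nat -> 'I_d -> nat) F t : (forall n j, (0 < N n j)%N) ->
  minN (N n) @[n --> \oo] --> \oo -> continuous (F \o tup) -> Td d t ->
  step (N n) F t @[n --> \oo] --> F t.
Proof.
move=> N0 hN Fc tT.
pose l n := projT1 (cid (@ex_cell R d (N n) (N0 n) t tT)).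
have hl n : cell (l n) t := projT2 (cid (@ex_cell R d (N n) (N0 n) t tT)).
rewrite (_ : (fun n => step (N n) F t) = (fun n => (F \o tup) (tnth (grid_pt (l n))))); last first.
  by apply/funext => n; rewrite (step_cell _ _ tT (hl n))//= tupK.
rewrite -[X in _ --> F X](tupK t).
apply: (@cvg_comp _ _ _ (fun n => tnth (grid_pt (l n)) : {ptws 'I_d -> R}) (F \o tup) _
  (nbhs (tnth t : {ptws 'I_d -> R}))); last exact: Fc.
apply: ptws_cvg => j.
have h n : 0 <= tnth t j - tnth (grid_pt (l n)) j <= 2 * pi / (N n j)%:R.
  exact: cell_grid_pt.
apply: (@squeeze_cvgr _ _ _ _ (fun n => tnth t j - 2 * pi / (N n j)%:R) (fun=> tnth t j)).
- by apply: nearW => n; have /andP[] := h n; rewrite subr_ge0 lerBlDl lerBlDr addrC => -> ->.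
- rewrite -[X in _ --> X]subr0; apply: cvgB; first exact: cvg_cst.
  exact: mesh_cvg.
- exact: cvg_cst.
Qed.

Let regular_grid (n : nat) (j : 'I_d) := n.+1.

Let regular_grid_cvg : (0 < d)%N -> minN (regular_grid n) @[n --> \oo] --> \oo.
Proof.
case: d @regular_grid => // d' regular_grid' _; apply/cvgnyPge => A; near=> n.
rewrite /minN; elim/big_ind: _ => [|x y h1 h2|j _].
- apply: (leq_trans _ (leq_bigmax ord0)); apply: leqW; near: n; exact: nbhs_infty_ge.
- by rewrite leq_min h1 h2.
- by apply: leqW; near: n; exact: nbhs_infty_ge.
Unshelve. all: by end_near. Qed.

(** A continuous function is the pointwise limit of its step functions, which are
    finite combinations of indicators of boxes. *)
Lemma measurable_continuous F : (0 < d)%N -> continuous (F \o tup) ->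
  measurable_fun (Td d) F.
Proof.
move=> d0 Fc; apply: (measurable_fun_cvg (h := fun n => step (regular_grid n) F)).
  by move=> n; exact: measurable_step.
by move=> t tT; apply: step_cvg => //; exact: regular_grid_cvg.
Qed.

Lemma integrable_continuous F : (0 < d)%N -> continuous (F \o tup) ->
  (mu d).-integrable (Td d) (EFin \o F).
Proof.
move=> d0 Fc; have [M hM] := bounded_on_Td Fc.
have mT := measurable_Td (R := R) (d := d).
apply: (measurable_bounded_integrable mT).
- by apply: le_lt_trans (probability_le1 (mu d) mT) (ltry _).
- exact: measurable_continuous.
- exists M; split; first exact: num_real.
  by move=> x Mx t tT; exact: le_trans (hM t tT) (ltW Mx).
Qed.

Definition Imu F : R := (\int[mu d]_(t in Td d) F t)%R.

Lemma integral_Imu F : (0 < d)%N -> continuous (F \o tup) ->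
  (\int[mu d]_(t in Td d) (F t)%:E = (Imu F)%:E)%E.
Proof.
move=> d0 Fc; rewrite /Imu /Rintegral fineK//.
exact: (integrable_fin_num (measurable_Td (R := R) (d := d)) (integrable_continuous d0 Fc)).
Qed.

Section MeanCvg.
Variable N : nat -> 'I_d -> nat.
Hypothesis (d0 : (0 < d)%N) (N0 : forall n j, (0 < N n j)%N).
Hypothesis Ncvg : minN (N n) @[n --> \oo] --> \oo.

(** Dominated convergence for the step functions of [F]. *)
Lemma mean_cvg F : continuous (F \o tup) ->
  mean (N n) F @[n --> \oo] --> Imu F.
Proof.
move=> Fc; have [M hM] := bounded_on_Td Fc.
have mT := measurable_Td (R := R) (d := d).
have mf : measurable_fun (Td d) (EFin \o F).
  by apply/measurable_EFinP; exact: measurable_continuous.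
have : (\int[mu d]_(t in Td d) (step (N n) F t)%:E)%E @[n --> \oo] -->
    (\int[mu d]_(t in Td d) (F t)%:E)%E.
  have [] // := @dominated_convergence _ _ _ (mu d) (Td d) mT
    (fun n t => (step (N n) F t)%:E) (EFin \o F) (cst M%:E).
  - by move=> n; apply/measurable_EFinP; exact: measurable_step.
  - have h (t : d.-tuple R) : Td d t ->
        (step (N n) F t)%:E @[n --> \oo] --> (EFin \o F) t.
      move=> tT; apply: cvg_EFin; first exact: nearW.
      exact: step_cvg.
    refine (aeW (mu d) h).
  - exact: finite_measure_integrable_cst.
  - have h (t : d.-tuple R) (n : nat) : Td d t ->
        (`|(step (N n) F t)%:E| <= cst M%:E t)%E.
      move=> tT; have [l tl] := @ex_cell R d (N n) (N0 n) t tT.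
      rewrite (step_cell _ _ tT tl)//= lee_fin.
      by apply: hM; apply: (@grid_Td _ _ (N n)); rewrite map_f// mem_enum.
    refine (aeW (mu d) h).
rewrite integral_Imu// => /fine_cvg; apply: cvg_trans; apply: near_eq_cvg.
by apply: nearW => n; rewrite /= integral_step.
Qed.

(** Joint continuity at [y] times the compact cube becomes continuity at [y]
    uniformly over the cube. *)
Lemma uniform_near (X : topologicalType) (Psi : X -> d.-tuple R -> R) (y : X) e :
  (forall a : {ptws 'I_d -> R},
     {for (y, a), continuous (fun xa : X * {ptws 'I_d -> R} => Psi xa.1 (tup xa.2))}) ->
  0 < e -> \forall x \near y, forall t, Td d t -> `|Psi x t - Psi y t| <= e.
Proof.
move=> Pc e0; pose P x a := `|Psi x (tup a) - Psi y (tup a)| <= e.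
have : \near y, cube `<=` P y.
  apply: (proj1 (compact_near_coveringP _) compact_cube) => a _.
  have /cvgrPdist_lt/(_ (e / 2)) := Pc a.
  rewrite divr_gt0// => /(_ isT)[[U V]/= [Uy Va] UV].
  exists (V, U) => // -[b x] /= [Vb Ux]; rewrite /P.
  have h1 := UV (x, b) (conj Ux Vb).
  have h2 := UV (y, b) (conj (nbhs_singleton Uy) Vb).
  rewrite /= in h1 h2.
  rewrite -(subrKA (Psi y (tup a))) (le_trans (ler_normD _ _))//.
  by rewrite [e]splitr lerD// ltW// distrC.
apply: filterS => x h t tT.
by have := h _ (Td_cube tT); rewrite /P tupK.
Qed.

(** The Riemann sums of [Psi x] converge also when [x] tends to [y] while the grid is
    refined: the change from [Psi x] to [Psi y] is uniformly small and averages do not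
    increase it. *)
Lemma mean_cvg_joint (X : topologicalType) (Psi : X -> d.-tuple R -> R) (y : X) :
  (forall a : {ptws 'I_d -> R},
     {for (y, a), continuous (fun xa : X * {ptws 'I_d -> R} => Psi xa.1 (tup xa.2))}) ->
  mean (N xn.2) (Psi xn.1) @[xn --> filter_prod (nbhs y) \oo] --> Imu (Psi y).
Proof.
move=> Pc; apply/cvgrPdist_le => e e0.
have Fc : continuous (Psi y \o tup).
  move=> a W Wn; have [[U V] /= [Uy Va] UV] := Pc a W Wn.
  apply: filterS Va => b Vb.
  exact: (UV (y, b) (conj (nbhs_singleton Uy) Vb)).
have e20 : 0 < e / 2 by rewrite divr_gt0.
have /cvgrPdist_le/(_ _ e20) h1 := mean_cvg Fc.
have h2 := uniform_near Pc e20.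
exists ([set x | forall t, Td d t -> `|Psi x t - Psi y t| <= e / 2],
  [set n | `|Imu (Psi y) - mean (N n) (Psi y)| <= e / 2]) => // -[x n] /= [hx hn].
rewrite -(subrKA (mean (N n) (Psi y))) (le_trans (ler_normD _ _))//.
rewrite [e]splitr lerD// distrC; exact: mean_dist.
Qed.

End MeanCvg.

End RiemannSums.

(** * Non-integrability at a zero of a nonnegative polynomial *)

Section ExtendedQuotient.
Context {R : realType}.

Lemma measurable_inv : measurable_fun [set: R] (fun x : R => x^-1).
Proof.
rewrite (_ : (fun x : R => x^-1) = (fun x => if x == 0 then 0 else x^-1)); last first.
  by apply/funext => x; case: eqP => // ->; rewrite invr0.
apply: measurable_fun_if => //.
  exact: measurable_fun_eqr.
rewrite setTI [X in measurable_fun X](_ : _ = ~` [set 0]); last first.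
  by apply/seteqP; split => x /=; [move/negbT/eqP|move/eqP/negbTE].
apply: open_continuous_measurable_fun; first by apply: closed_openC; exact: closed_eq.
by move=> x; rewrite inE/= => /eqP x0; exact: inv_continuous.
Qed.

Lemma measurable_inve : measurable_fun [set: R] (fun x : R => (x%:E)^-1%E).
Proof.
rewrite (_ : (fun x => _) = (fun x : R => if x == 0 then +oo%E else (x^-1)%:E)).
  apply: measurable_fun_ifT => //; first exact: measurable_fun_eqr.
  by apply/measurable_EFinP; exact: measurable_inv.
by apply/funext => x; rewrite inver.
Qed.

Lemma measurable_quot d (T : measurableType d) (D : set T) (f g : T -> R) :
  measurable_fun D f -> measurable_fun D g ->
  measurable_fun D (fun t => ((f t)%:E / (g t)%:E)%E).
Proof.
move=> mf mg; apply: emeasurable_funM; first exact/measurable_EFinP.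
exact: (measurableT_comp measurable_inve).
Qed.

Lemma EFin_quot (x y : R) : y != 0 -> (x%:E / y%:E = (x / y)%:E)%E.
Proof. by move=> y0; rewrite inver (negbTE y0). Qed.

Lemma quot_ge (c x y : R) : 0 < c -> 0 <= x <= y -> 0 < y ->
  ((c / y)%:E <= c%:E / x%:E)%E.
Proof.
move=> c0 /andP[x0 xy] y0; rewrite inver; case: eqP => [_|/eqP xN].
  by rewrite gt0_muley ?lte_fin// leey.
by rewrite -EFinM lee_fin ler_wpM2l ?(ltW c0)// lef_pV2 ?posrE// lt_neqAle eq_sym xN.
Qed.

Lemma quot_ge0 (x y : R) : 0 <= x -> 0 <= y -> (0 <= x%:E / y%:E)%E.
Proof.
move=> x0 y0; rewrite inver; case: eqP => _; first by rewrite mule_ge0.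
by rewrite -EFinM lee_fin divr_ge0.
Qed.

End ExtendedQuotient.

Section NonIntegrable.
Context {R : realType} {d : nat} {Lam : {fset 'rV[int]_d}}.

Lemma trig_quadratic (p : {ptws Lam -> R}) t0 : (forall t, 0 <= trig p t) -> trig p t0 = 0 ->
  exists2 C, 0 < C & forall r t, (forall j, `|tnth t j - tnth t0 j| <= r) ->
    trig p t <= C * r ^+ 2.
Proof.
move=> p0 pt0.
pose S (k : Lam) : R := \sum_j `|(val k ord0 j)%:~R|.
exists (1 + \sum_(k : Lam) 2 * `|p k| * S k ^+ 2).
  by rewrite ltr_wpDr// sumr_ge0// => k _; rewrite mulr_ge0 ?sqr_ge0// mulr_ge0.
move=> r t tr.
pose h : d.-tuple R := [tuple tnth t j - tnth t0 j | j < d].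
have -> : t = tadd t0 h.
  by apply: eq_from_tnth => j; rewrite !tnth_mktuple addrC subrK.
apply: le_trans (trig_zero_bound h p0 pt0) _.
rewrite mulrDl mul1r mulr_suml; apply: ler_wpDl; first exact: sqr_ge0.
apply: ler_sum => k _; rewrite -[leRHS]mulrA -exprMn; apply: ler_wpM2l.
  by rewrite mulr_ge0.
have hS : `|pairing (val k) h| <= S k * r.
  rewrite /pairing (le_trans (ler_norm_sum _ _ _))// mulr_suml; apply: ler_sum => j _.
  by rewrite normrM ler_wpM2l// tnth_mktuple.
rewrite -(real_normK (num_real (pairing _ _))) lerXn2r ?nnegrE//.
exact: le_trans (normr_ge0 _) hS.
Qed.

(** Near [t0] the polynomial is at most [C r^2] on a box of side [r], so [h] is at least
    [c / (C r^2)^k] there. For [d <= 2 k] the shell between the boxes of sides [r] and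
    [r / 2] then contributes an amount bounded below independently of [r], and
    infinitely many disjoint shells fit into [Td d]. The boxes extend from [t0] in the
    positive directions only, in order to stay inside [Td d]. *)
Lemma nonintegrable_quot (p : {ptws Lam -> R}) t0 k c (h : d.-tuple R -> \bar R) :
  (0 < d)%N -> (d <= 2 * k)%N -> 0 < c -> Td d t0 ->
  (forall t, 0 <= trig p t) -> trig p t0 = 0 ->
  measurable_fun (Td d) h ->
  (forall t, Td d t -> c%:E / (trig p t ^+ k)%:E <= h t)%E ->
  (\int[mu d]_(t in Td d) h t = +oo)%E.
Proof.
move=> d0 dk c0 t0T p0 pt0 mh hh.
have [C C0 hC] := trig_quadratic p0 pt0.
have h0 t : Td d t -> (0 <= h t)%E.
  move=> tT; apply: le_trans (hh t tT).
  by apply: quot_ge0; rewrite ?exprn_ge0// ltW.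
have [r0 [r00 r01 r0T]] : exists r0 : R, [/\ 0 < r0, r0 <= 1 &
    forall j, tnth t0 j + r0 <= 2 * pi].
  pose r0 : R := \big[Num.min/1]_(j < d) (2 * pi - tnth t0 j).
  exists r0; split.
  - rewrite /r0; elim/big_ind: _ => // [x y x0 y0|j _]; first by rewrite lt_min x0.
    by have := t0T j; rewrite in_itv/= subr_gt0 => /andP[].
  - by rewrite /r0; elim/big_rec: _ => // j x _; rewrite ge_min orbC => ->.
  - move=> j; rewrite -lerBrDl /r0.
    have := mem_index_enum j; move: (1 : R) => one; elim: (index_enum _) => // i s IH.
    by rewrite in_cons big_cons ge_min => /orP[/eqP<-|/IH ->]; rewrite ?lexx ?orbT.
pose r n : R := r0 / 2 ^+ n.
have r_gt0 n : 0 < r n by rewrite divr_gt0.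
have r_le n : r n <= r0.
  by rewrite ler_pdivrMr ?exprn_gt0// ler_peMr ?(ltW r00)// exprn_ege1// ler1n.
have rS n : r n.+1 = r n / 2 by rewrite /r exprSr invfM mulrA.
pose B n : set (d.-tuple R) := box (tnth t0) (fun j => tnth t0 j + r n).
have mB n : measurable (B n) by exact: measurable_box.
have t00 j : 0 <= tnth t0 j by have := t0T j; rewrite in_itv/= => /andP[].
have muB n : mu d (B n) = ((r n / (2 * pi)) ^+ d)%:E.
  rewrite mu_box => [|j]; last first.
    split=> //; first by rewrite lerDl ltW.
    by rewrite (le_trans _ (r0T j))// lerD2l.
  under eq_bigr do rewrite addrAC subrr add0r.
  by rewrite prodr_const card_ord.
have BT n : B n `<=` Td d.
  move=> t tB j; have := tB j; rewrite !in_itv/= => /andP[h1 h2].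
  rewrite (le_trans (t00 j) h1)/= (lt_le_trans h2)// (le_trans _ (r0T j))//.
  by rewrite lerD2l.
have BS n : B n.+1 `<=` B n.
  move=> t tB j; have := tB j; rewrite !in_itv/= => /andP[-> h2].
  rewrite (lt_le_trans h2)// lerD2l rS ler_pdivrMr// ler_peMr ?(ltW (r_gt0 _))//.
  by rewrite ler1n.
(* lower bound for each shell: the box of side r has mass (r / (2 pi)) ^ d, at
   least half of it lies in the shell, and r ^ d >= r ^ (2 k) as r <= 1 *)
pose K : R := c / C ^+ k * ((2 * pi)^-1 ^+ d / 2).
have K0 : 0 < K.
  by rewrite mulr_gt0// divr_gt0// exprn_gt0// invr_gt0 twopi_gt0.
have shell n : (K%:E <= \int[mu d]_(t in B n `\` B n.+1) h t)%E.
  have mD : measurable (B n `\` B n.+1) by exact: measurableD.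
  have muD : mu d (B n `\` B n.+1) =
      ((r n / (2 * pi)) ^+ d - (r n.+1 / (2 * pi)) ^+ d)%:E.
    rewrite measureD//; last first.
      by apply: le_lt_trans (probability_le1 (mu d) (mB n)) (ltry _).
    by rewrite (setIidr (BS n)) [X in (X - _)%E]muB [X in (_ - X)%E]muB -EFinB.
  apply: (@le_trans _ _ (\int[mu d]_(t in B n `\` B n.+1) cst (c / (C * r n ^+ 2) ^+ k)%:E t)%E); last first.
    apply: ge0_le_integral => //.
    - by move=> t _; rewrite lee_fin divr_ge0// ?(ltW c0)// exprn_ge0// mulr_ge0 ?(ltW C0)// sqr_ge0.
    - by apply: measurable_funS mh => //; [exact: measurable_Td|move=> t [/BT]].
    - move=> t [tB _]; apply: le_trans (hh t (BT _ _ tB)).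
      have Cr : 0 < C * r n ^+ 2 by rewrite mulr_gt0// exprn_gt0.
      apply: quot_ge => //; last by rewrite exprn_gt0.
      rewrite exprn_ge0//= lerXn2r ?nnegrE ?(ltW Cr)//.
      apply: hC => j; have := tB j; rewrite in_itv/= => /andP[h1 h2].
      by rewrite ger0_norm ?subr_ge0// lerBlDl ltW.
  rewrite integral_cst// [X in (_ <= _ * X)%E]muD -EFinM lee_fin.
  rewrite rS [r n / 2 / _]mulrAC; set x := r n / (2 * pi).
  have x0 : 0 < x by rewrite divr_gt0// twopi_gt0.
  have half : x ^+ d / 2 <= x ^+ d - (x / 2) ^+ d.
    rewrite lerBrDr [(x / 2) ^+ d]expr_div_n [leRHS]splitr lerD2l.
    apply: ler_wpM2l; first by rewrite exprn_ge0// ltW.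
    by rewrite lef_pV2 ?posrE ?exprn_gt0// -{1}[2]expr1 ler_weXn2l// ler1n.
  have Crk : 0 < (C * r n ^+ 2) ^+ k by rewrite exprn_gt0// mulr_gt0// exprn_gt0.
  apply: le_trans (ler_wpM2l _ half); last by rewrite divr_ge0// ltW.
  have -> : c / (C * r n ^+ 2) ^+ k * (x ^+ d / 2) =
      K * (r n ^+ d / r n ^+ (2 * k)).
    rewrite /K /x exprMn [(r n / _) ^+ d]exprMn -exprM invfM.
    by ring.
  rewrite ler_peMr ?(ltW K0)// ler_pdivlMr ?exprn_gt0// mul1r.
  apply: ler_wiXn2l => //; first exact: ltW.
  exact: le_trans (r_le n) r01.
have key n : ((K *+ n)%:E <= \int[mu d]_(t in B 0%N) h t)%E.
  suff : ((K *+ n)%:E + \int[mu d]_(t in B n) h t <= \int[mu d]_(t in B 0%N) h t)%E.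
    apply: le_trans; rewrite leeDl//; apply: integral_ge0 => t tB; apply: h0; exact: BT tB.
  elim: n => [|n IH]; first by rewrite mulr0n add0e.
  apply: le_trans IH; rewrite mulrSr EFinD -addeA leeD2l//.
  rewrite -[X in (_ <= \int[mu d]_(_ in X) _)%E](setDUK (BS n)).
  rewrite ge0_integral_setU//; last 4 first.
  - exact: measurableD.
  - rewrite (setDUK (BS n)); apply: measurable_funS mh => //; exact: measurable_Td.
  - by rewrite (setDUK (BS n)) => t tB; apply: h0; exact: BT tB.
  - by apply/disj_setPS => t [tB [_]]; apply.
  by rewrite addeC leeD2l.
apply/eqyP => A A0.
apply: (@le_trans _ _ (K *+ (Num.truncn (A / K)).+1)%:E).
  by rewrite lee_fin -mulr_natr mulrC -ler_pdivrMr// ltW// truncnS_gt.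
apply: le_trans (key _) _.
exact: (ge0_subset_integral (mu d) (mB 0%N) (@measurable_Td R d) mh h0 (BT 0%N)).
Qed.

End NonIntegrable.

(** * Polynomials as functions of coefficients and angles *)

Section TrigContinuity.
Context {R : realType} {d : nat} {Lam : {fset 'rV[int]_d}}.
Implicit Types (p q : {ptws Lam -> R}).

Lemma cvg_finite_sum T (F : set_system T) (I : Type) (r : seq I) (f : I -> T -> R) (l : I -> R) :
  Filter F -> (forall i, f i x @[x --> F] --> l i) ->
  \sum_(i <- r) f i x @[x --> F] --> \sum_(i <- r) l i.
Proof.
move=> FF h; elim: r => [|i r IH].
  by rewrite big_nil; under eq_fun do rewrite big_nil; exact: cvg_cst.
by rewrite big_cons; under eq_fun do rewrite big_cons; exact: cvgD.
Qed.

Lemma trig_cvg T (F : set_system T) (p_ : T -> {ptws Lam -> R})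
    (a_ : T -> {ptws 'I_d -> R}) p (a : {ptws 'I_d -> R}) : Filter F ->
  (forall k, p_ x k @[x --> F] --> p k) -> (forall j, a_ x j @[x --> F] --> a j) ->
  trig (p_ x) (tup (a_ x)) @[x --> F] --> trig p (tup a).
Proof.
move=> FF hp ha; rewrite trigE; under eq_fun do rewrite trigE.
apply: cvg_finite_sum => k; apply: cvgM; first exact: hp.
apply: continuous_cvg; first exact: continuous_cos.
rewrite /pairing; apply: cvg_finite_sum => j; rewrite tnth_mktuple.
under eq_fun do rewrite tnth_mktuple.
by apply: cvgMr; exact: ha.
Qed.

Lemma ptws_coord (U : choiceType) (g : {ptws U -> R}) u : h u @[h --> g] --> g u.
Proof. exact: (@proj_continuous U (fun=> R) u g). Qed.

Lemma cvg_near_fst (X Y : topologicalType) (V : Type) (x : X) (y : Y) (g : X -> V) (l : set_system V) :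
  g @ x --> l -> g z.1 @[z --> (x, y)] --> l.
Proof.
move=> h W /h Wx; exists (g @^-1` W, setT) => /=; first by split => //; exact: filterT.
by move=> [u v] [].
Qed.

Lemma cvg_near_snd (X Y : topologicalType) (V : Type) (x : X) (y : Y) (g : Y -> V) (l : set_system V) :
  g @ y --> l -> g z.2 @[z --> (x, y)] --> l.
Proof.
move=> h W /h Wx; exists (setT, g @^-1` W) => /=; first by split => //; exact: filterT.
by move=> [u v] [].
Qed.

Lemma trig_continuous p : continuous (trig p \o tup).
Proof.
move=> a; apply: (@trig_cvg _ (nbhs a) (fun=> p) (fun a => a)) => [k|j].
  exact: cvg_cst.
exact: ptws_coord.
Qed.

Lemma trig_diff p q t : `|trig p t - trig q t| <= \sum_k `|p k - q k|.
Proof.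
rewrite !trigE -sumrB (le_trans (ler_norm_sum _ _ _))//; apply: ler_sum => k _.
by rewrite -mulrBl normrM ler_piMr// cos_max.
Qed.

(** The point at parameter [s] of the segment from [p] to [q]. *)
Definition segment (p q : {ptws Lam -> R}) (s : R) : {ptws Lam -> R} :=
  fun k => p k + s * (q k - p k).

Lemma trig_segment p q s t :
  trig (segment p q s) t = trig p t + s * (trig q t - trig p t).
Proof.
rewrite !trigE -sumrB mulr_sumr -big_split; apply: eq_bigr => k _ /=.
by rewrite /segment; ring.
Qed.

Lemma dot_segment p q s c :
  dot (segment p q s) c = dot p c + s * (dot q c - dot p c).
Proof.
rewrite /dot -sumrB mulr_sumr -big_split; apply: eq_bigr => k _ /=.
by rewrite /segment; ring.
Qed.

Lemma even_segment p q s : even_coef p -> even_coef q -> even_coef (segment p q s).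
Proof. by move=> hp hq k l kl; rewrite /segment (hp k l kl) (hq k l kl). Qed.

Lemma normalized_segment p q s : normalized p -> normalized q -> normalized (segment p q s).
Proof. by move=> hp hq k k0; rewrite /segment (hp k k0) (hq k k0) subrr mulr0 addr0. Qed.

Lemma trig_everywhere p (P : R -> Prop) :
  (forall t, Td d t -> P (trig p t)) -> forall t, P (trig p t).
Proof. by move=> h t; have [t' /h + e] := Td_repr t; rewrite e. Qed.

(** The reciprocal is continuous, hence bounded on the compact cube. *)
Lemma trig_lower p : (forall t, 0 < trig p t) -> exists2 a, 0 < a & forall t, a <= trig p t.
Proof.
move=> p0; have [|M hM] := @bounded_on_Td R d (fun t => (trig p t)^-1).
  by move=> a; exact: (cvgV (lt0r_neq0 (p0 (tup a))) (@trig_continuous p a)).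
have M0 : 0 < `|M| + 1 by rewrite ltr_wpDl.
exists (`|M| + 1)^-1; first by rewrite invr_gt0.
apply: (@trig_everywhere p (fun x => (`|M| + 1)^-1 <= x)) => t /hM.
rewrite ger0_norm; last by rewrite invr_ge0 ltW.
move=> h.
rewrite -[leRHS]invrK lef_pV2 ?posrE ?invr_gt0// (le_trans h)//.
by rewrite (le_trans (ler_norm M))// lerDl.
Qed.

Lemma closed_preim (X : topologicalType) (f : X -> R) (D : set R) :
  continuous f -> closed D -> closed (f @^-1` D).
Proof. by move=> fc Dc; apply: preimage_closed => // x _; exact: fc. Qed.

Lemma closed_even : closed [set p : {ptws Lam -> R} | even_coef p].
Proof.
rewrite (_ : [set p | _] = \bigcap_(kl in [set kl : Lam * Lam | val kl.2 = - val kl.1])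
    (fun p : {ptws Lam -> R} => p kl.2 - p kl.1) @^-1` [set x | x = 0]); last first.
  apply/seteqP; split => p /= hp.
    by move=> [k l] /= kl; rewrite (hp k l kl) subrr.
  by move=> k l kl; apply/eqP; rewrite -subr_eq0; apply/eqP; exact: (hp (k, l)).
apply: closed_bigI => -[k l] _; apply: closed_preim; last exact: closed_eq.
move=> p; exact: (@cvgB _ _ _ (nbhs p) _ (fun h : {ptws Lam -> R} => h l)
  (fun h => h k) (p l) (p k) (@ptws_coord Lam p l) (@ptws_coord Lam p k)).
Qed.

Lemma closed_normalized : closed [set p : {ptws Lam -> R} | normalized p].
Proof.
rewrite (_ : [set p | _] = \bigcap_(k in [set k : Lam | val k = 0])
    (fun p : {ptws Lam -> R} => p k) @^-1` [set x | x = 1]); last first.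
  by apply/seteqP; split => p /= hp k; exact: hp.
apply: closed_bigI => k _; apply: closed_preim; last exact: closed_eq.
by move=> p; exact: (@ptws_coord Lam p k).
Qed.

Lemma trig_continuousl t : continuous (fun p : {ptws Lam -> R} => trig p t).
Proof.
move=> p; rewrite -(tupK t).
apply: (@trig_cvg _ (nbhs p) (fun p => p) (fun=> tnth t)) => [k|j].
  exact: ptws_coord.
exact: cvg_cst.
Qed.

Lemma closed_trig_ge0 t : closed [set p : {ptws Lam -> R} | 0 <= trig p t].
Proof. exact: (closed_preim (@trig_continuousl t) (@closed_ge R 0)). Qed.

Lemma closure_Pplus p : closure (Pplus Lam) p -> even_coef p /\ forall t, 0 <= trig p t.
Proof.
move=> hp; split.
  by apply: closed_even; apply: closureS hp => q [].
apply: (@trig_everywhere p (fun x => 0 <= x)) => t tT.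
by apply: closed_trig_ge0; apply: closureS hp => q [_ /(_ t tT)/ltW].
Qed.

Lemma closure_Pplus_o p : closure (Pplus_o Lam) p ->
  [/\ even_coef p, normalized p & forall t, 0 <= trig p t].
Proof.
move=> hp; have [h1 h2] : even_coef p /\ forall t, 0 <= trig p t.
  by apply: closure_Pplus; apply: closureS hp => q [].
by split=> //; apply: closed_normalized; apply: closureS hp => q [].
Qed.

Lemma positive_feasible p q : even_coef p -> even_coef q -> normalized p ->
  (forall t, 0 < trig p t) -> (forall t, 0 < trig q t) -> continuous_feasible Lam (p, q).
Proof. by move=> *; split; apply: subset_closure; [split=> //; split|split]. Qed.

End TrigContinuity.

(** * The dual function at positive polynomials *)

Section EtaIntegral.
Context {R : realType} {d : nat}.

(** Off the grid, [f] may be infinite or negative; only its finite values on the grid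
    contribute. *)
Lemma integral_eta_EFin (N : 'I_d -> nat) (f : d.-tuple R -> \bar R) (g : d.-tuple R -> R) :
  measurable_fun (Td d) f -> (forall t, t \in grid N -> f t = (g t)%:E) ->
  (\int[eta N]_(t in Td d) f t = (mean N g)%:E)%E.
Proof.
move=> mf fg; rewrite integralE.
rewrite integral_eta//; last exact: measurable_funepos.
rewrite integral_eta//; last exact: measurable_funeneg.
have -> : (\sum_(t <- grid N) f^\+%E t)%E = (\sum_(t <- grid N) Num.max (g t) 0)%:E.
  rewrite -sumEFin big_seq [RHS]big_seq; apply: eq_bigr => t tN.
  by rewrite funeposE fg// EFin_max.
have -> : (\sum_(t <- grid N) f^\-%E t)%E = (\sum_(t <- grid N) Num.max (- g t) 0)%:E.
  rewrite -sumEFin big_seq [RHS]big_seq; apply: eq_bigr => t tN.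
  by rewrite funenegE fg// EFin_max EFinN.
rewrite -!EFinM -EFinB -mulrBr -sumrB /mean; congr (_ * _)%:E.
apply: eq_bigr => t _; have [g0|g0] := leP 0 (g t).
  by rewrite max_r ?subr0// oppr_le0.
by rewrite max_l ?sub0r ?opprK// oppr_ge0 ltW.
Qed.

End EtaIntegral.

Section RealFunctional.
Context {R : realType} {d : nat} {Lam : {fset 'rV[int]_d}}.
Implicit Types (p q c m : {ptws Lam -> R}) (I : (d.-tuple R -> R) -> R).

(** The dual function with [nu = k.+1], for an averaging operator [I] in place of the
    integral: [Imu] gives the continuous problem and [mean N] the discrete one. *)
Definition Jr I (k : nat) (lam : R) c m p q : R :=
  k%:R^-1 * I (fun t => persp k (trig p t) (trig q t)) + dot q c - dot p m
  + lam / k%:R * I (fun t => persp k 1 (trig p t)).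

Lemma persp_cvg T (F : set_system T) k (u v : T -> R) (a b : R) : Filter F ->
  b != 0 -> u x @[x --> F] --> a -> v x @[x --> F] --> b ->
  persp k (u x) (v x) @[x --> F] --> persp k a b.
Proof.
move=> FF b0 ua vb.
have X (w : T -> R) (l : R) n : w x @[x --> F] --> l -> w x ^+ n @[x --> F] --> l ^+ n.
  move=> wl; elim: n => [|n IH]; first exact: cvg_cst.
  rewrite exprS; under eq_fun do rewrite exprS.
  exact: (cvgM wl IH).
exact: (cvgM (X _ _ k.+1 ua) (cvgV (expf_neq0 k b0) (X _ _ k vb))).
Qed.

Lemma trig_cvg_fst p q (a : {ptws 'I_d -> R}) :
  trig xa.1.1 (tup xa.2) @[xa --> ((p, q), a)] --> trig p (tup a).
Proof.
apply: (@trig_cvg _ _ _ _ (nbhs ((p, q), a)) (fun xa => xa.1.1) (fun xa => xa.2)) => [k|j].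
  exact: (@cvg_near_fst ({ptws Lam -> R} * {ptws Lam -> R})%type {ptws 'I_d -> R}
    _ (p, q) a (fun h => h.1 k) (nbhs (p k))
    (@cvg_near_fst {ptws Lam -> R} {ptws Lam -> R} _ p q (fun h => h k) (nbhs (p k))
      (@ptws_coord R Lam p k))).
exact: (@cvg_near_snd ({ptws Lam -> R} * {ptws Lam -> R})%type {ptws 'I_d -> R}
    _ (p, q) a (fun h => h j) (nbhs (a j)) (@ptws_coord R _ a j)).
Qed.

Lemma trig_cvg_snd p q (a : {ptws 'I_d -> R}) :
  trig xa.1.2 (tup xa.2) @[xa --> ((p, q), a)] --> trig q (tup a).
Proof.
apply: (@trig_cvg _ _ _ _ (nbhs ((p, q), a)) (fun xa => xa.1.2) (fun xa => xa.2)) => [k|j].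
  exact: (@cvg_near_fst ({ptws Lam -> R} * {ptws Lam -> R})%type {ptws 'I_d -> R}
    _ (p, q) a (fun h => h.2 k) (nbhs (q k))
    (@cvg_near_snd {ptws Lam -> R} {ptws Lam -> R} _ p q (fun h => h k) (nbhs (q k))
      (@ptws_coord R Lam q k))).
exact: (@cvg_near_snd ({ptws Lam -> R} * {ptws Lam -> R})%type {ptws 'I_d -> R}
    _ (p, q) a (fun h => h j) (nbhs (a j)) (@ptws_coord R _ a j)).
Qed.

Lemma persp_continuous k p q : (forall t, 0 < trig q t) ->
  continuous ((fun t => persp k (trig p t) (trig q t)) \o tup).
Proof.
move=> q0 a.
exact: (@persp_cvg _ (nbhs a) k (trig p \o tup) (trig q \o tup) _ _ _
  (lt0r_neq0 (q0 (tup a))) (@trig_continuous R d Lam p a) (@trig_continuous R d Lam q a)).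
Qed.

Lemma persp1_continuous k p : (forall t, 0 < trig p t) ->
  continuous ((fun t => persp k 1 (trig p t)) \o tup).
Proof.
move=> p0 a.
exact: (@persp_cvg _ (nbhs a) k (cst 1) (trig p \o tup) _ _ _
  (lt0r_neq0 (p0 (tup a))) (cvg_cst (1 : R)) (@trig_continuous R d Lam p a)).
Qed.

Lemma trig_measurable p : (0 < d)%N -> measurable_fun (Td d) (trig p).
Proof. by move=> d0; apply: measurable_continuous => //; exact: trig_continuous. Qed.

Lemma integrand1E k p q t : 0 < trig q t ->
  ((trig p t ^+ k.+1)%:E / (trig q t ^+ k)%:E = (persp k (trig p t) (trig q t))%:E)%E.
Proof. by move=> q0; rewrite EFin_quot// expf_neq0// gt_eqF. Qed.

Lemma integrand2E k p t : 0 < trig p t ->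
  (1 / (trig p t ^+ k)%:E = (persp k 1 (trig p t))%:E)%E.
Proof. by move=> p0; rewrite EFin_quot ?expf_neq0 ?gt_eqF// /persp expr1n. Qed.

Lemma J_mu k lam c m p q : (0 < d)%N ->
  (forall t, 0 < trig p t) -> (forall t, 0 < trig q t) ->
  J (mu d) k.+1 lam c m p q = (Jr Imu k lam c m p q)%:E.
Proof.
move=> d0 p0 q0; rewrite /J /Jr -natr1 addrK /=.
rewrite (eq_integral (fun t => (persp k (trig p t) (trig q t))%:E)); last first.
  by move=> t _; rewrite integrand1E.
rewrite (integral_Imu d0 (persp_continuous (k := k) (p := p) q0)).
rewrite (eq_integral (fun t => (persp k 1 (trig p t))%:E)); last first.
  by move=> t _; rewrite integrand2E.
by rewrite (integral_Imu d0 (persp1_continuous (k := k) p0)).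
Qed.

Lemma J_eta (N : 'I_d -> nat) k lam c m p q : (0 < d)%N ->
  (forall t, t \in grid N -> 0 < trig p t /\ 0 < trig q t) ->
  J (eta N) k.+1 lam c m p q = (Jr (mean N) k lam c m p q)%:E.
Proof.
move=> d0 pq0; rewrite /J /Jr -natr1 addrK /=.
rewrite (integral_eta_EFin (g := fun t => persp k (trig p t) (trig q t))); last 2 first.
- by apply: measurable_quot; apply: measurable_funX; exact: trig_measurable.
- by move=> t /pq0[_ q0]; rewrite integrand1E.
rewrite (integral_eta_EFin (g := fun t => persp k 1 (trig p t)))//.
- by apply: measurable_quot => //; apply: measurable_funX; exact: trig_measurable.
- by move=> t /pq0[p0 _]; rewrite integrand2E.
Qed.

End RealFunctional.

(** * Strict positivity of the integral and convexity of Riemann sums *)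

Section ZeroIntegral.
Context {R : realType} {d : nat}.
Implicit Types (F G H : d.-tuple R -> R).

Lemma cvg_defect T (E : set_system T) (f g h : T -> R) (a b c : R) : Filter E ->
  f @ E --> a -> g @ E --> b -> h @ E --> c ->
  f x + g x - 2 * h x @[x --> E] --> a + b - 2 * c.
Proof.
move=> FE fa gb hc; apply: cvgB; first exact: cvgD.
exact: cvgMr.
Qed.

Lemma continuous_defect F G H :
  continuous (F \o tup) -> continuous (G \o tup) -> continuous (H \o tup) ->
  continuous ((fun t => F t + G t - 2 * H t) \o tup).
Proof.
move=> Fc Gc Hc a.
exact: (@cvg_defect _ (nbhs a) (F \o tup) (G \o tup) (H \o tup) _ _ _ _ (Fc a) (Gc a) (Hc a)).
Qed.

Lemma Imu_defect F G H : (0 < d)%N ->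
  continuous (F \o tup) -> continuous (G \o tup) -> continuous (H \o tup) ->
  Imu (fun t => F t + G t - 2 * H t) = Imu F + Imu G - 2 * Imu H.
Proof.
move=> d0 Fc Gc Hc; have mT := @measurable_Td R d.
have iF := integrable_continuous d0 Fc; have iG := integrable_continuous d0 Gc.
have iH := integrable_continuous d0 Hc.
have iFG : (mu d).-integrable (Td d) (EFin \o (fun t => F t + G t)).
  exact: (integrableD mT iF iG).
have iH2 : (mu d).-integrable (Td d) (EFin \o (fun t => 2 * H t)).
  exact: (integrableZl mT 2 iH).
by rewrite /Imu RintegralB// RintegralD// RintegralZl.
Qed.

(** If [F t > 0], then [F >= F t / 2] on one of the boxes with lower corner [t] that
    shrink to [t], and these boxes have positive mass. *)
Lemma Imu_le0 F : (0 < d)%N -> continuous (F \o tup) ->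
  (forall t, Td d t -> 0 <= F t) -> Imu F <= 0 -> forall t, Td d t -> F t = 0.
Proof.
move=> d0 Fc F0 IF t tT; apply/eqP; rewrite eq_le F0// andbT leNgt; apply/negP => Ft.
(* the sides are fractions of the distance to 2 pi, so the boxes stay in Td d *)
pose b n (j : 'I_d) : R := tnth t j + (2 * pi - tnth t j) / n.+1%:R.
have tj j : 0 <= tnth t j < 2 * pi by have := tT j; rewrite in_itv.
have bj n j : tnth t j < b n j <= 2 * pi.
  have /andP[t0 t1] := tj j; rewrite /b ltrDl divr_gt0 ?subr_gt0//= addrC -lerBrDr.
  rewrite ler_pdivrMr//; apply: ler_peMr; last by rewrite ler1n.
  by rewrite subr_ge0 ltW.
have [n hn] : exists n, forall s, box (tnth t) (b n) s -> F t / 2 <= F s.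
  apply: contrapT => /forallNP h.
  have /choice[s hs] n : exists s, box (tnth t) (b n) s /\ F s < F t / 2.
    by have /existsNP[s /not_implyP[h1 h2]] := h n; exists s; split=> //; rewrite ltNge; apply/negP.
  have st : F (s n) @[n --> \oo] --> F t.
    rewrite (_ : (fun n => F (s n)) = (fun n => (F \o tup) (tnth (s n)))); last first.
      by apply/funext => n; rewrite /= tupK.
    rewrite -[X in _ --> F X](tupK t).
    apply: (@cvg_comp _ _ _ (fun n => tnth (s n) : {ptws 'I_d -> R}) (F \o tup) _
      (nbhs (tnth t : {ptws 'I_d -> R}))); last exact: Fc.
    apply: ptws_cvg => j.
    apply: (@squeeze_cvgr _ _ _ _ (fun=> tnth t j) (fun n => b n j)).
    - by apply: nearW => n; have [/(_ j)] := hs n; rewrite in_itv/= => /andP[-> /ltW].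
    - exact: cvg_cst.
    - rewrite -[X in _ --> X]addr0; apply: cvgD; first exact: cvg_cst.
      rewrite -[X in _ --> X](mulr0 (2 * pi - tnth t j)).
      by apply: cvgMr; exact: cvg_harmonic.
  have : F t <= F t / 2.
    rewrite -{1}(cvg_lim (@Rhausdorff R) st); apply: limr_le; first exact: cvgP st.
    by apply: nearW => n; exact/ltW/(hs n).2.
  by rewrite leNgt gtr_pMr// invf_lt1// ltr1n.
have mT := @measurable_Td R d.
have mB : measurable (box (tnth t) (b n)) by exact: measurable_box.
have : (\int[mu d]_(s in Td d) (F t / 2 * \1_(box (tnth t) (b n)) s)%:E <=
    \int[mu d]_(s in Td d) (F s)%:E)%E.
  apply: ge0_le_integral => //.
  - by move=> s sT; rewrite lee_fin mulr_ge0// divr_ge0// ltW.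
  - by apply/measurable_EFinP; apply: measurable_funM => //; exact: measurable_indic.
  - by apply/measurable_EFinP; exact: measurable_continuous.
  - move=> s sT; rewrite lee_fin indicE; have [/set_mem sB|sB] := boolP (s \in _).
      by rewrite mulr1; exact: hn.
    by rewrite mulr0; exact: F0.
rewrite (integral_Imu d0 Fc); under eq_integral do rewrite EFinM.
rewrite integralZl//; last first.
  by apply: integrableS (integrable_indic (mu d) mB) => //.
rewrite integral_indic// setIidl; last first.
  move=> s sB j; have := sB j; rewrite !in_itv/= => /andP[h1 h2].
  have /andP[t0 _] := tj j; have /andP[_ b2] := bj n j.
  by rewrite (le_trans t0 h1) (lt_le_trans h2 b2).
have muB : mu d (box (tnth t) (b n)) = (\prod_(j < d) ((b n j - tnth t j) / (2 * pi)))%:E.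
  rewrite mu_box// => j; have /andP[t0 _] := tj j; have /andP[b1 b2] := bj n j.
  by split=> //; exact: ltW.
rewrite [X in (_ * X <= _)%E]muB -EFinM lee_fin => h; have := le_trans h IF; rewrite leNgt; case/negP.
rewrite mulr_gt0 ?divr_gt0// prodr_gt0// => j _.
by rewrite divr_gt0 ?twopi_gt0// subr_gt0; have /andP[] := bj n j.
Qed.

End ZeroIntegral.

Section MeanConvex.
Context {R : realType} {d : nat} {Lam : {fset 'rV[int]_d}}.
Implicit Types (p q c m : {ptws Lam -> R}).

Lemma mean_convex (N : 'I_d -> nat) (F G H : d.-tuple R -> R) s :
  (forall t, t \in grid N -> H t <= F t + s * (G t - F t)) ->
  mean N H <= mean N F + s * (mean N G - mean N F).
Proof.
move=> h; rewrite /mean -mulrBr mulrCA -mulrDr -sumrB [s * _]mulr_sumr -big_split/=.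
apply: ler_wpM2l; first by rewrite invr_ge0.
rewrite big_seq [leRHS]big_seq; apply: ler_sum => t tN; exact: h.
Qed.

Lemma Jr_mean_convex (N : 'I_d -> nat) k lam c m p q p' q' s :
  0 <= lam -> 0 <= s <= 1 ->
  (forall t, t \in grid N -> 0 < trig p t /\ 0 < trig q t) ->
  (forall t, t \in grid N -> 0 < trig p' t /\ 0 < trig q' t) ->
  Jr (mean N) k lam c m (segment p p' s) (segment q q' s) <=
  Jr (mean N) k lam c m p q + s * (Jr (mean N) k lam c m p' q' - Jr (mean N) k lam c m p q).
Proof.
move=> lam0 s01 h h'; rewrite /Jr !dot_segment.
have e1 : mean N (fun t => persp k (trig (segment p p' s) t) (trig (segment q q' s) t)) <=
   mean N (fun t => persp k (trig p t) (trig q t)) + s *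
  (mean N (fun t => persp k (trig p' t) (trig q' t)) - mean N (fun t => persp k (trig p t) (trig q t))).
  apply: mean_convex => t tN; rewrite !trig_segment.
  by have [] := h t tN; have [] := h' t tN; move=> *; exact: persp_convex.
have e2 : mean N (fun t => persp k 1 (trig (segment p p' s) t)) <=
   mean N (fun t => persp k 1 (trig p t)) + s *
  (mean N (fun t => persp k 1 (trig p' t)) - mean N (fun t => persp k 1 (trig p t))).
  apply: mean_convex => t tN; rewrite !trig_segment.
  have [h1 _] := h t tN; have [h2 _] := h' t tN.
  have := @persp_convex R k s 1 (trig p t) 1 (trig p' t) s01 ltr01 h1 ltr01 h2.
  by rewrite subrr mulr0 addr0.
have k0 : 0 <= k%:R^-1 :> R by rewrite invr_ge0.
have lk0 : 0 <= lam / k%:R by rewrite divr_ge0.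
have h1 := ler_wpM2l k0 e1; have h2 := ler_wpM2l lk0 e2.
apply: (le_trans (lerD (lerD (lerD h1 (lexx _)) (lexx _)) h2)).
by rewrite le_eqVlt; apply/orP; left; apply/eqP; ring.
Qed.

End MeanConvex.

(** * The minimizer of the continuous problem *)

Section Arithmetic.
Context {R : realFieldType}.
Implicit Types x y z : R.

Lemma half01 : 0 <= (1 / 2 : R) <= 1. Proof. by apply/andP; split; lra. Qed.

Lemma midpoint_defect_ge0 x y z : z <= x + 1 / 2 * (y - x) -> 0 <= x + y - 2 * z.
Proof. by move=> ?; lra. Qed.

Lemma midpoint_defect_eq0 x y z : x + y - 2 * z = 0 -> x + y <= z *+ 2.
Proof. by rewrite mulr2n => ?; lra. Qed.

(** Suppose a functional [u A + q - p + v B] with affine [q] and [p] is not larger at a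
    first point than at a second one, nor at the second than at their midpoint. Then
    the weighted midpoint defects of [A] and [B] have a nonpositive sum. *)
Lemma midpoint_functional (u v A A' Az B B' Bz q q' p p' : R) :
  u * A + q - p + v * B <= u * A' + q' - p' + v * B' ->
  u * A' + q' - p' + v * B' <=
    u * Az + (q + 1 / 2 * (q' - q)) - (p + 1 / 2 * (p' - p)) + v * Bz ->
  u * (A + A' - 2 * Az) + v * (B + B' - 2 * Bz) <= 0.
Proof.
rewrite !mulrBr !mulrDr ![_ * (2 * _)]mulrCA.
move: (u * A) (u * A') (u * Az) (v * B) (v * B') (v * Bz) => a a' az b b' bz h1 h2.
lra.
Qed.

Lemma le0_of_sum_le0 x y : 0 <= x -> 0 <= y -> x + y <= 0 -> x <= 0.
Proof. by move=> *; lra. Qed.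

End Arithmetic.

Section ContinuousMinimizer.
Context {R : realType} {d : nat} {Lam : {fset 'rV[int]_d}}.
Variables (k : nat) (lam : R) (c m phat qhat : {ptws Lam -> R}).
Hypotheses (d0 : (0 < d)%N) (dk : (d <= 2 * k)%N) (lam0 : 0 < lam).
Hypotheses (Lam0 : 0 \in Lam) (Lam_sym : forall l : 'rV[int]_d, l \in Lam -> - l \in Lam).
Hypothesis hhat : is_solution (continuous_feasible Lam) (J (mu d) k.+1 lam c m) phat qhat.
Implicit Types (p q : {ptws Lam -> R}).

Let k0 : (0 < k)%N.
Proof. by move: d0 dk; case: k => //; rewrite muln0; case: d. Qed.

Let kR : 0 < k%:R :> R. Proof. by rewrite ltr0n. Qed.

Definition one_poly : {ptws Lam -> R} := fun l => if val l == 0 then 1 else 0.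

Lemma trig_one t : trig one_poly t = 1.
Proof.
rewrite trigE (bigD1 [` Lam0]%fset)//= big1 => [|l l0].
  rewrite /one_poly /= eqxx addr0 mul1r (_ : pairing _ _ = 0) ?cos0//.
  by rewrite /pairing big1// => j _; rewrite mxE mul0r.
rewrite /one_poly; case: eqP => [e|]; last by rewrite mul0r.
by case/eqP: l0; apply: val_inj.
Qed.

Lemma even_one : even_coef one_poly.
Proof. by move=> l l' e; rewrite /one_poly e oppr_eq0. Qed.

Lemma normalized_one : normalized one_poly.
Proof. by move=> l e; rewrite /one_poly e eqxx. Qed.

Lemma J_hat_finite : (J (mu d) k.+1 lam c m phat qhat < +oo)%E.
Proof.
have one0 t : 0 < trig one_poly t by rewrite trig_one.
have := hhat.2 one_poly one_poly (positive_feasible even_one even_one normalized_one one0 one0).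
by rewrite (J_mu k lam c m d0 one0 one0) => /le_lt_trans; apply; exact: ltry.
Qed.

Let first_term (p q : {ptws Lam -> R}) :=
  (\int[mu d]_(t in Td d) ((trig p t ^+ k.+1)%:E / (trig q t ^+ k)%:E))%E.
Let last_term (p : {ptws Lam -> R}) :=
  (\int[mu d]_(t in Td d) (1 / (trig p t ^+ k)%:E))%E.

Lemma J_infinite p q : (forall t, 0 <= trig p t) -> (forall t, 0 <= trig q t) ->
  first_term p q = +oo%E \/ last_term p = +oo%E -> J (mu d) k.+1 lam c m p q = +oo%E.
Proof.
move=> p0 q0 h; rewrite /J -natr1 addrK /= -/(first_term p q) -/(last_term p).
have f0 : (0 <= first_term p q)%E.
  by apply: integral_ge0 => t _; apply: quot_ge0; exact: exprn_ge0.
have l0 : (0 <= last_term p)%E.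
  by apply: integral_ge0 => t _; apply: quot_ge0 => //; exact: exprn_ge0.
have kV : 0 < k%:R^-1 :> R by rewrite invr_gt0.
have lk : 0 < lam / k%:R by rewrite divr_gt0.
have B0 : ((lam / k%:R)%:E * last_term p != -oo)%E.
  by rewrite -ltNye (lt_le_trans (ltNyr 0))// mule_ge0// lee_fin ltW.
have A0 : (k%:R^-1%:E * first_term p q != -oo)%E.
  by rewrite -ltNye (lt_le_trans (ltNyr 0))// mule_ge0// lee_fin ltW.
case: h => ->.
  by rewrite gt0_muley ?lte_fin// addye// -EFinN addye// addye.
rewrite gt0_muley ?lte_fin// addey//.
by case: (_ * first_term p q)%E A0.
Qed.

(** A pair in the closure has nonnegative polynomials, and by [nonintegrable_quot] a zero
    of the first makes the regularizing term infinite; once the first is bounded below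
    by a positive constant, a zero of the second makes the leading term infinite. The
    value at the minimizer is finite because it is finite at the constants [(1, 1)]. *)
Lemma hat_feasible : [/\ even_coef phat, normalized phat, even_coef qhat,
  forall t, 0 < trig phat t & forall t, 0 < trig qhat t].
Proof.
have [[/closure_Pplus_o[pe pn p0] /closure_Pplus[qe q0]] _] := hhat.
have fin := J_hat_finite.
have mp := trig_measurable phat d0; have mq := trig_measurable qhat d0.
have pp t : 0 < trig phat t.
  rewrite lt_neqAle p0 andbT eq_sym; apply/negP => /eqP pt.
  have [t0 t0T e] := Td_repr t; have pt0 : trig phat t0 = 0 by rewrite e.
  have : last_term phat = +oo%E.
    apply: (nonintegrable_quot d0 dk ltr01 t0T p0 pt0) => //.
    by apply: measurable_quot => //; exact: measurable_funX.
  by move=> h; move: fin; rewrite J_infinite//; right.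
have [a a0 ha] := trig_lower pp.
split=> // t; rewrite lt_neqAle q0 andbT eq_sym; apply/negP => /eqP qt.
have [t0 t0T e] := Td_repr t; have qt0 : trig qhat t0 = 0 by rewrite e.
have : first_term phat qhat = +oo%E.
  apply: (nonintegrable_quot d0 dk (exprn_gt0 k.+1 a0) t0T q0 qt0) => //.
    by apply: measurable_quot => //; exact: measurable_funX.
  move=> s _; apply: lee_wpmul2r; first by rewrite inve_ge0 lee_fin exprn_ge0.
  by rewrite lee_fin lerXn2r ?nnegrE// ltW.
by move=> h; move: fin; rewrite J_infinite//; left.
Qed.

(** The midpoint of two minimizers cannot do better, so the nonnegative convexity
    defects of both integrands have zero integral and vanish pointwise. The defect of
    the regularizing term gives [P = Phat]; with equal first arguments, the defect of the
    leading term gives [Q = Qhat]. Equal functions have equal coefficients by [trig_eq0]. *)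
Lemma minimizer_unique p q : even_coef p -> even_coef q -> normalized p ->
  (forall t, 0 < trig p t) -> (forall t, 0 < trig q t) ->
  Jr Imu k lam c m p q <= Jr Imu k lam c m phat qhat ->
  (forall l, p l = phat l) /\ (forall l, q l = qhat l).
Proof.
move=> pe qe pn p0 q0 hle.
have [he hn qhe hp0 hq0] := hat_feasible.
pose z := segment p phat (1 / 2); pose w := segment q qhat (1 / 2).
have zE t : trig z t = (trig p t + trig phat t) / 2.
  by rewrite trig_segment; field.
have wE t : trig w t = (trig q t + trig qhat t) / 2.
  by rewrite trig_segment; field.
have z0 t : 0 < trig z t by rewrite zE divr_gt0// addr_gt0.
have w0 t : 0 < trig w t by rewrite wE divr_gt0// addr_gt0.
have : Jr Imu k lam c m phat qhat <= Jr Imu k lam c m z w.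
  have := hhat.2 z w (positive_feasible (even_segment _ pe he) (even_segment _ qe qhe)
    (normalized_segment _ pn hn) z0 w0).
  by rewrite (J_mu k lam c m d0 z0 w0) (J_mu k lam c m d0 hp0 hq0) lee_fin.
pose F1 (p q : {ptws Lam -> R}) (t : d.-tuple R) := persp k (trig p t) (trig q t).
pose F2 (p : {ptws Lam -> R}) (t : d.-tuple R) := persp k 1 (trig p t).
pose D1 t := F1 p q t + F1 phat qhat t - 2 * F1 z w t.
pose D2 t := F2 p t + F2 phat t - 2 * F2 z t.
have c1 := persp_continuous (k := k) (p := p) q0.
have c1h := persp_continuous (k := k) (p := phat) hq0.
have c1z := persp_continuous (k := k) (p := z) w0.
have c2 := persp1_continuous (k := k) p0.
have c2h := persp1_continuous (k := k) hp0.
have c2z := persp1_continuous (k := k) z0.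
have E1 : Imu D1 = Imu (F1 p q) + Imu (F1 phat qhat) - 2 * Imu (F1 z w).
  exact: (Imu_defect d0 c1 c1h c1z).
have E2 : Imu D2 = Imu (F2 p) + Imu (F2 phat) - 2 * Imu (F2 z).
  exact: (Imu_defect d0 c2 c2h c2z).
have cD1 : continuous (D1 \o tup) by exact: (continuous_defect c1 c1h c1z).
have cD2 : continuous (D2 \o tup) by exact: (continuous_defect c2 c2h c2z).
have half := @half01 R.
have D1_0 t : 0 <= D1 t.
  have := persp_convex k half (p0 t) (q0 t) (hp0 t) (hq0 t).
  by rewrite -!trig_segment -/z -/w => h; exact: midpoint_defect_ge0.
have D2_0 t : 0 <= D2 t.
  have := persp_convex k half ltr01 (p0 t) ltr01 (hp0 t).
  by rewrite -!trig_segment -/z subrr mulr0 addr0 => h; exact: midpoint_defect_ge0.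
have Imu_ge0 (F : d.-tuple R -> R) : (forall t, 0 <= F t) -> 0 <= Imu F.
  by move=> F0; apply: Rintegral_ge0.
have I1 := Imu_ge0 _ D1_0; have I2 := Imu_ge0 _ D2_0.
rewrite /Jr !dot_segment => hz.
have : k%:R^-1 * Imu D1 + lam / k%:R * Imu D2 <= 0.
  rewrite E1 E2; exact: midpoint_functional hle hz.
have kV : 0 < k%:R^-1 :> R by rewrite invr_gt0.
have lk : 0 < lam / k%:R by rewrite divr_gt0.
have m1 := mulr_ge0 (ltW kV) I1; have m2 := mulr_ge0 (ltW lk) I2.
move=> sle.
have D1le : Imu D1 <= 0 by rewrite -(pmulr_rle0 _ kV); exact: (le0_of_sum_le0 m1 m2).
have D2le : Imu D2 <= 0 by rewrite -(pmulr_rle0 _ lk); apply: (le0_of_sum_le0 m2 m1); rewrite addrC.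
have pp t : Td d t -> trig p t = trig phat t.
  move=> tT; have := Imu_le0 d0 cD2 (fun t _ => D2_0 t) D2le tT.
  move=> e; have := @persp_midpoint_eq R k 1 (trig p t) 1 (trig phat t) k0 ltr01 (p0 t) ltr01 (hp0 t).
  rewrite !mul1r => h; apply/esym/h.
  rewrite (_ : (1 + 1) / 2 = 1 :> R); last by field.
  by rewrite -zE; exact: midpoint_defect_eq0.
have qq t : Td d t -> trig q t = trig qhat t.
  move=> tT; have := Imu_le0 d0 cD1 (fun t _ => D1_0 t) D1le tT.
  move=> e; have := @persp_midpoint_eq R k (trig p t) (trig q t) (trig phat t) (trig qhat t) k0 (p0 t) (q0 t) (hp0 t) (hq0 t).
  rewrite pp// => h; apply: (mulfI (lt0r_neq0 (hp0 t))); apply/esym/h.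
  move: e; rewrite /D1 /F1 zE wE pp//.
  exact: midpoint_defect_eq0.
have eq0 (f g : {ptws Lam -> R}) : even_coef f -> even_coef g ->
    (forall t, Td d t -> trig f t = trig g t) -> forall l, f l = g l.
  move=> fe ge fg l.
  pose r : {ptws Lam -> R} := fun l => f l - g l.
  have rE t : trig r t = trig f t - trig g t.
    by rewrite !trigE -sumrB; apply: eq_bigr => i _; rewrite /r mulrBl.
  apply/eqP; rewrite -subr_eq0; apply/eqP; apply: (trig_eq0 (p := r) Lam_sym).
    by move=> i j ij; rewrite /r (fe i j ij) (ge i j ij).
  apply: (@trig_everywhere _ _ _ r (fun x => x = 0)) => t tT.
  by rewrite rE fg// subrr.
by split; exact: eq0.
Qed.

End ContinuousMinimizer.

(** * Functions on the torus and joint limits *)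

Section Torus.
Context {R : realType} {d : nat}.

Lemma normc_le (u v : R) : `|(u +i* v)%C : Cx R| <= toC (`|u| + `|v|).
Proof.
rewrite normc_def /= lecR -(ger0_norm (addr_ge0 (normr_ge0 u) (normr_ge0 v))) -sqrtr_sqr.
apply: ler_wsqrtr; rewrite sqrrD !real_normK ?num_real// addrAC lerDl.
by rewrite mulrn_wge0// mulr_ge0.
Qed.

Lemma normc_expi (x : R) : `|expi x| = 1.
Proof. by rewrite normc_def /= cos2Dsin2 sqrtr1. Qed.

Lemma expi_continuous : continuous (@expi R).
Proof.
move=> x; apply/cvgrPdist_lt => e e0.
have [r r0 re] : exists2 r : R, 0 < r & toC r = e.
  exists (complex.Re e); last first.
    by rewrite /toC RRe_real// ger0_real// ltW.
  by move: e0; rewrite ltcE => /andP[].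
have r20 : 0 < r / 2 by rewrite divr_gt0.
have hc : \forall y \near x, `|cos x - cos y| < r / 2.
  by have /cvgrPdist_lt/(_ _ r20) := @continuous_cos R x.
have hs : \forall y \near x, `|sin x - sin y| < r / 2.
  by have /cvgrPdist_lt/(_ _ r20) := @continuous_sin R x.
near=> y; apply: le_lt_trans (normc_le (cos x - cos y) (sin x - sin y)) _.
rewrite -re ltcR [r]splitr ltrD//.
  by near: y.
by near: y.
Unshelve. all: by end_near. Qed.

Lemma torus_expiv (t : d.-tuple R) : torus d (expiv t).
Proof. by move=> j; rewrite mxE normc_expi. Qed.

Lemma expiv_continuous : continuous (@expiv R d \o tup).
Proof.
move=> a W [B hB BW].
have h : \forall b \near (a : {ptws 'I_d -> R}), forall i j, B i j (expi (b j)).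
  apply: (@filter_forall _ _ (fun i b => forall j, B i j (expi (b j))) (nbhs (a : {ptws 'I_d -> R})) (@nbhs_filter {ptws 'I_d -> R} a)) => i.
  apply: (@filter_forall _ _ (fun j b => B i j (expi (b j))) (nbhs (a : {ptws 'I_d -> R})) (@nbhs_filter {ptws 'I_d -> R} a)) => j.
  have : nbhs (expi (a j)) (B i j) by have := hB i j; rewrite mxE tnth_mktuple.
  by move=> /(@expi_continuous (a j)); exact: (@ptws_coord R _ a j).
apply: (@filterS _ _ (@nbhs_filter {ptws 'I_d -> R} a) _ _ _ h) => b {}h; apply: BW => i j.
by rewrite mxE tnth_mktuple; exact: h.
Qed.

Lemma torus_continuous (f : 'rV[Cx R]_d -> R) : {within torus d, continuous f} ->
  continuous ((f \o @expiv R d) \o tup).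
Proof.
move=> /subspace_continuousP fc a W Wn.
pose V : set 'rV[Cx R]_d := [set z | torus d z -> W (f z)].
have h0 : nbhs (expiv (tup a)) V := fc _ (torus_expiv (tup a)) W Wn.
have h : nbhs (a : {ptws 'I_d -> R}) ((@expiv R d \o tup) @^-1` V).
  exact: (@expiv_continuous a V h0).
apply: (@filterS _ _ (@nbhs_filter {ptws 'I_d -> R} a) _ _ _ h) => b hb.
by apply: hb; exact: torus_expiv.
Qed.

End Torus.

Section JointLimit.
Context {R : realType} {d : nat} {Lam : {fset 'rV[int]_d}}.
Variables (k : nat) (lam : R) (c m : {ptws Lam -> R}).
Variable N : nat -> 'I_d -> nat.
Hypothesis (d0 : (0 < d)%N) (N0 : forall n j, (0 < N n j)%N).
Hypothesis Ncvg : minN (N n) @[n --> \oo] --> \oo.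
Implicit Types (p q : {ptws Lam -> R}).

Local Notation X := ({ptws Lam -> R} * {ptws Lam -> R})%type.

Lemma cvg_prod_fst (T S U : Type) (F : set_system T) (G : set_system S) (g : T -> U) (l : set_system U) :
  Filter G -> g @ F --> l -> g z.1 @[z --> filter_prod F G] --> l.
Proof.
move=> FG h W /h Wx; exists (g @^-1` W, setT) => /=; first by split => //; exact: filterT.
by move=> [u v] [].
Qed.

Lemma cvg_coord_fst p q l : (fun x : X => x.1 l) @ (p, q) --> p l.
Proof.
exact: (@cvg_near_fst {ptws Lam -> R} {ptws Lam -> R} _ p q (fun h => h l) (nbhs (p l))
  (@ptws_coord R Lam p l)).
Qed.

Lemma cvg_coord_snd p q l : (fun x : X => x.2 l) @ (p, q) --> q l.
Proof.
exact: (@cvg_near_snd {ptws Lam -> R} {ptws Lam -> R} _ p q (fun h => h l) (nbhs (q l))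
  (@ptws_coord R Lam q l)).
Qed.

Lemma dot_cvg T (F : set_system T) (p_ : T -> {ptws Lam -> R}) p v : Filter F ->
  (forall l, p_ x l @[x --> F] --> p l) -> dot (p_ x) v @[x --> F] --> dot p v.
Proof. by move=> FF h; apply: cvg_finite_sum => l; apply: cvgMl; exact: h. Qed.

(** The discrete dual functions converge to the continuous one, locally uniformly near
    any pair of positive polynomials. *)
Lemma Jr_joint p q : (forall t, 0 < trig p t) -> (forall t, 0 < trig q t) ->
  Jr (mean (N xn.2)) k lam c m xn.1.1 xn.1.2 @[xn --> filter_prod (nbhs (p, q)) \oo]
    --> Jr Imu k lam c m p q.
Proof.
move=> p0 q0.
have c1 := mean_cvg_joint d0 N0 Ncvg
  (Psi := fun (x : X) t => persp k (trig x.1 t) (trig x.2 t)) (y := (p, q)).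
have c2 := mean_cvg_joint d0 N0 Ncvg
  (Psi := fun (x : X) t => persp k 1 (trig x.1 t)) (y := (p, q)).
have dp : (fun xn : X * nat => dot xn.1.1 m) @ filter_prod (nbhs (p, q)) \oo --> dot p m.
  have h : (fun x : X => dot x.1 m) @ nbhs (p, q) --> dot p m.
    exact: (@dot_cvg _ (nbhs (p, q)) (fun x => x.1) p m _ (@cvg_coord_fst p q)).
  exact: (@cvg_prod_fst _ _ _ (nbhs (p, q)) \oo (fun x : X => dot x.1 m) (nbhs (dot p m)) _ h).
have dq : (fun xn : X * nat => dot xn.1.2 c) @ filter_prod (nbhs (p, q)) \oo --> dot q c.
  have h : (fun x : X => dot x.2 c) @ nbhs (p, q) --> dot q c.
    exact: (@dot_cvg _ (nbhs (p, q)) (fun x => x.2) q c _ (@cvg_coord_snd p q)).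
  exact: (@cvg_prod_fst _ _ _ (nbhs (p, q)) \oo (fun x : X => dot x.2 c) (nbhs (dot q c)) _ h).
apply: cvgD; first apply: cvgB; first apply: cvgD.
- apply: cvgMr; apply: c1 => a.
  exact: (@persp_cvg R _ (nbhs ((p, q), a)) k _ _ _ _ _ (lt0r_neq0 (q0 (tup a)))
    (@trig_cvg_fst R d Lam p q a) (@trig_cvg_snd R d Lam p q a)).
- exact: dq.
- exact: dp.
- apply: cvgMr; apply: c2 => a.
  exact: (@persp_cvg R _ (nbhs ((p, q), a)) k _ _ _ _ _ (lt0r_neq0 (p0 (tup a)))
    (cvg_cst (1 : R)) (@trig_cvg_fst R d Lam p q a)).
Qed.

End JointLimit.

(** * Convergence of the discrete minimizers *)

Section Sphere.
Context {R : realType} {d : nat} {Lam : {fset 'rV[int]_d}}.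
Implicit Types (p q : {ptws Lam -> R}).
Local Notation X := ({ptws Lam -> R} * {ptws Lam -> R})%type.
Variables phat qhat : {ptws Lam -> R}.

Definition dist (x : X) : R :=
  \sum_l `|x.1 l - phat l| + \sum_l `|x.2 l - qhat l|.

Lemma dist_continuous : continuous dist.
Proof.
move=> [p q].
have h1 : (fun x : X => \sum_l `|x.1 l - phat l|) @ nbhs (p, q) --> \sum_l `|p l - phat l|.
  apply: cvg_finite_sum => l; apply: cvg_norm; apply: cvgB; first exact: cvg_coord_fst.
  exact: cvg_cst.
have h2 : (fun x : X => \sum_l `|x.2 l - qhat l|) @ nbhs (p, q) --> \sum_l `|q l - qhat l|.
  apply: cvg_finite_sum => l; apply: cvg_norm; apply: cvgB; first exact: cvg_coord_snd.
  exact: cvg_cst.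
exact: (@cvgD _ _ _ (nbhs (p, q)) _ _ _ _ _ h1 h2).
Qed.

Definition sphere (e : R) : set X :=
  [set x : X | dist x = e] `&` [set x : X | even_coef x.1] `&`
  [set x : X | normalized x.1] `&` [set x : X | even_coef x.2].

Lemma compact_sphere e : compact (sphere e).
Proof.
pose B (p : {ptws Lam -> R}) : set {ptws Lam -> R} :=
  [set g | forall l, `[p l - e, p l + e]%classic (g l)].
have cB p : compact (B p).
  exact: (@tychonoff Lam (fun=> R) (fun l => `[p l - e, p l + e]%classic)
    (fun l => @segment_compact R _ _)).
apply: (@subclosed_compact _ _ (B phat `*` B qhat)).
- apply: closedI; first apply: closedI; first apply: closedI.
  + exact: (closed_preim dist_continuous (@closed_eq R e)).
  + apply: (@preimage_closed X {ptws Lam -> R} fst _ _ closed_even) => x _; exact: cvg_fst.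
  + apply: (@preimage_closed X {ptws Lam -> R} fst _ _ closed_normalized) => x _; exact: cvg_fst.
  + apply: (@preimage_closed X {ptws Lam -> R} snd _ _ closed_even) => x _; exact: cvg_snd.
- exact: compact_setX.
- move=> x [[[/= xe _] _] _].
  have in_itv_dist (u v : R) : `|u - v| <= e -> u \in `[v - e, v + e].
    by move=> h; rewrite in_itv/= -ler_distlC distrC.
  have s0 (f : Lam -> R) l : `|f l| <= \sum_i `|f i|.
    by rewrite (bigD1 l)//= lerDl sumr_ge0.
  split=> l /=; apply: in_itv_dist; rewrite -xe /dist.
    by rewrite (le_trans (s0 (fun l => x.1 l - phat l) l))// lerDl sumr_ge0.
  by rewrite (le_trans (s0 (fun l => x.2 l - qhat l) l))// lerDr sumr_ge0.
Qed.

End Sphere.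

Section WeightedRatio.
Context {R : realType}.

Lemma weighted_ratio_cvg T (F : set_system T) n (w u v : T -> R) (c a b : R) : Filter F ->
  b != 0 -> w x @[x --> F] --> c -> u x @[x --> F] --> a -> v x @[x --> F] --> b ->
  w x * (u x / v x) ^+ n @[x --> F] --> c * (a / b) ^+ n.
Proof.
move=> FF b0 wc ua vb; apply: cvgM => //.
have uv : u x / v x @[x --> F] --> a / b := cvgM ua (cvgV b0 vb).
elim: n => [|n IH]; first exact: cvg_cst.
rewrite exprS; under eq_fun do rewrite exprS.
by apply: cvgM; [exact: uv|exact: IH].
Qed.

End WeightedRatio.

Section Convergence.
Context {R : realType} {d : nat} {Lam : {fset 'rV[int]_d}}.
Variables (k : nat) (lam : R) (c m phat qhat : {ptws Lam -> R}).
Hypotheses (d0 : (0 < d)%N) (dk : (d <= 2 * k)%N) (lam0 : 0 < lam).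
Hypotheses (Lam0 : 0 \in Lam) (Lam_sym : forall l : 'rV[int]_d, l \in Lam -> - l \in Lam).
Hypothesis hhat : is_solution (continuous_feasible Lam) (J (mu d) k.+1 lam c m) phat qhat.
Variable N : nat -> 'I_d -> nat.
Hypothesis N0 : forall n j, (0 < N n j)%N.
Hypothesis Ncvg : minN (N n) @[n --> \oo] --> \oo.
Variables pN qN : nat -> {ptws Lam -> R}.
Hypothesis hN : forall n, is_solution (discrete_feasible Lam (N n))
  (J (eta (N n)) k.+1 lam c m) (pN n) (qN n).

Local Notation X := ({ptws Lam -> R} * {ptws Lam -> R})%type.

Lemma discrete_le n : Jr (mean (N n)) k lam c m (pN n) (qN n) <=
  Jr (mean (N n)) k lam c m phat qhat.
Proof.
have [pe pn qe p0 q0] := hat_feasible d0 dk lam0 Lam0 hhat.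
have [[_ _ _ pq0] /(_ phat qhat)] := hN n.
rewrite (J_eta k lam c m d0 pq0) (J_eta k lam c m d0 (fun t _ => conj (p0 t) (q0 t))) lee_fin.
by apply; split.
Qed.

(** Each point of the sphere is a pair of positive polynomials, as [e] is below the
    minima of [Phat] and [Qhat], and by uniqueness the continuous dual function is
    strictly larger there than at the minimizer. The strict inequality passes to the
    discrete functions near each point for fine grids, and to the whole sphere by
    compactness. *)
Lemma near_sphere e a : 0 < e < a -> (forall t, a <= trig phat t) -> (forall t, a <= trig qhat t) ->
  \forall n \near \oo, forall x, sphere phat qhat e x ->
    Jr (mean (N n)) k lam c m phat qhat < Jr (mean (N n)) k lam c m x.1 x.2.
Proof.
move=> /andP[e0 ea] pa qa.
have [he hn qhe hp0 hq0] := hat_feasible d0 dk lam0 Lam0 hhat.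
have jh := Jr_joint (k := k) (lam := lam) (c := c) (m := m) d0 N0 Ncvg hp0 hq0.
apply: (proj1 (compact_near_coveringP _) (@compact_sphere R d Lam phat qhat e) nat \oo
  (fun n x => Jr (mean (N n)) k lam c m phat qhat < Jr (mean (N n)) k lam c m x.1 x.2)).
move=> [p q] [[[/= xe pe] pn] qe].
have p0 t : 0 < trig p t.
  have := trig_diff phat p t; have := pa t.
  have : \sum_l `|phat l - p l| <= e.
    rewrite -xe /dist/=; under eq_bigr do rewrite distrC.
    by rewrite lerDl sumr_ge0.
  move=> h1 h2 /(le_trans (ler_norm _)) h3.
  have := le_trans h3 h1; rewrite lerBlDr -lerBlDl => h; apply: lt_le_trans h.
  by rewrite subr_gt0 (lt_le_trans ea).
have q0 t : 0 < trig q t.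
  have := trig_diff qhat q t; have := qa t.
  have : \sum_l `|qhat l - q l| <= e.
    rewrite -xe /dist/=; under [leLHS]eq_bigr do rewrite distrC.
    by rewrite lerDr sumr_ge0.
  move=> h1 h2 /(le_trans (ler_norm _)) h3.
  have := le_trans h3 h1; rewrite lerBlDr -lerBlDl => h; apply: lt_le_trans h.
  by rewrite subr_gt0 (lt_le_trans ea).
have lt : Jr Imu k lam c m phat qhat < Jr Imu k lam c m p q.
  rewrite ltNge; apply/negP => le.
  have [hp hq] := minimizer_unique d0 dk lam0 Lam0 Lam_sym hhat pe qe pn p0 q0 le.
  move: e0; rewrite -xe /dist /= !big1 ?addr0 ?ltxx// => l _.
    by rewrite hq subrr normr0.
  by rewrite hp subrr normr0.
have jx := Jr_joint (k := k) (lam := lam) (c := c) (m := m) d0 N0 Ncvg p0 q0.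
pose mid := (Jr Imu k lam c m phat qhat + Jr Imu k lam c m p q) / 2.
have mid1 : Jr Imu k lam c m phat qhat < mid by rewrite midf_lt.
have mid2 : mid < Jr Imu k lam c m p q by rewrite midf_lt.
have [[U V] /= [Uh Vh] hUV] := jh _ (open_nbhs_nbhs (conj (@open_lt R mid) mid1)).
have [[U' V'] /= [Ux Vx] hUV'] := jx _ (open_nbhs_nbhs (conj (@open_gt R mid) mid2)).
exists (U', V `&` V'); first by split => //; exact: filterI.
move=> [x n] /= [Ux' [Vn Vn']].
apply: (lt_trans (hUV ((phat, qhat), n) (conj (nbhs_singleton Uh) Vn))).
exact: (hUV' (x, n) (conj Ux' Vn')).
Qed.

(** If the discrete minimizer were outside the sphere, the segment joining it to
    [(phat, qhat)] would cross the sphere at a point where, by convexity, the discrete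
    function does not exceed its value at [(phat, qhat)], contrary to [near_sphere].
    Polynomials positive on the grid are enough for that convexity. *)
Lemma dist_le_near e a : 0 < e < a -> (forall t, a <= trig phat t) -> (forall t, a <= trig qhat t) ->
  \forall n \near \oo, dist phat qhat (pN n, qN n) <= e.
Proof.
move=> ea pa qa; apply: filterS (near_sphere ea pa qa) => n hs.
rewrite leNgt; apply/negP => De.
have /andP[e0 _] := ea.
have [he hn qhe hp0 hq0] := hat_feasible d0 dk lam0 Lam0 hhat.
have [[/= pe qe pn pq0] _] := hN n.
set D := dist phat qhat (pN n, qN n) in De.
have D0 : 0 < D := lt_trans e0 De.
pose s := e / D.
have s01 : 0 <= s <= 1.
  by rewrite divr_ge0 ?(ltW e0) ?(ltW D0)//= ler_pdivrMr// mul1r ltW.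
pose y : X := (segment phat (pN n) s, segment qhat (qN n) s).
have yS : sphere phat qhat e y.
  split; last exact: even_segment.
  split; last exact: normalized_segment.
  split; last exact: even_segment.
  rewrite /= /dist /y /= /segment.
  under eq_bigr do rewrite addrAC subrr add0r normrM.
  under [X in _ + X]eq_bigr do rewrite addrAC subrr add0r normrM.
  rewrite -!mulr_sumr -mulrDr -/(dist phat qhat (pN n, qN n)) -/D.
  by have /andP[s0 _] := s01; rewrite ger0_norm// divfK// gt_eqF.
have := hs y yS; rewrite ltNge => /negP; apply.
apply: le_trans (Jr_mean_convex _ _ _ (ltW lam0) s01 _ pq0) _ => //.
rewrite gerDl; have /andP[s0 _] := s01.
by rewrite mulr_ge0_le0// subr_le0 discrete_le.
Qed.

Lemma minimizers_cvg : (fun n => (pN n, qN n) : X) @ \oo --> ((phat, qhat) : X).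
Proof.
have [he hn qhe hp0 hq0] := hat_feasible d0 dk lam0 Lam0 hhat.
have [a a0 pa] := trig_lower hp0; have [b b0 qb] := trig_lower hq0.
have near_le e : 0 < e -> \forall n \near \oo, dist phat qhat (pN n, qN n) <= e.
  move=> e0; pose r := Num.min a b; pose f := Num.min e (r / 2).
  have r0 : 0 < r by rewrite lt_min a0.
  have f0 : 0 < f < r.
    rewrite lt_min e0 divr_gt0//= gt_min; apply/orP; right.
    by rewrite gtr_pMr// invf_lt1// ltr1n.
  apply: filterS (dist_le_near f0 _ _) => [n h|t|t].
  - by rewrite (le_trans h)// ge_min lexx.
  - by rewrite (le_trans _ (pa t))// ge_min lexx.
  - by rewrite (le_trans _ (qb t))// ge_min lexx orbT.
have s0 (f : Lam -> R) l : `|f l| <= \sum_i `|f i|.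
  by rewrite (bigD1 l)//= lerDl sumr_ge0.
have cp : (pN : nat -> {ptws Lam -> R}) @ \oo --> (phat : {ptws Lam -> R}).
  apply: ptws_cvg => l; apply/cvgrPdist_le => e e0.
  apply: filterS (near_le e e0) => n; apply: le_trans; rewrite distrC /dist/=.
  by rewrite (le_trans (s0 (fun l => pN n l - phat l) l))// lerDl sumr_ge0.
have cq : (qN : nat -> {ptws Lam -> R}) @ \oo --> (qhat : {ptws Lam -> R}).
  apply: ptws_cvg => l; apply/cvgrPdist_le => e e0.
  apply: filterS (near_le e e0) => n; apply: le_trans; rewrite distrC /dist/=.
  by rewrite (le_trans (s0 (fun l => qN n l - qhat l) l))// lerDr sumr_ge0.
move=> W [[U V] /= [Uh Vh] UV].
have hUV : \forall n \near \oo, U (pN n) /\ V (qN n).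
  by apply: filterI; [exact: cp U Uh|exact: cq V Vh].
suff : \forall n \near \oo, W (pN n, qN n) by [].
apply: filterS hUV => n [h1 h2].
exact: (UV (pN n, qN n) (conj h1 h2)).
Qed.

Lemma spectrum_cvg (f : 'rV[Cx R]_d -> R) : {within torus d, continuous f} ->
  (\int[eta (N n)]_(t in Td d) (f (expiv t) * Phi k.+1 (pN n) (qN n) t)%:E)%E @[n --> \oo]
  --> (\int[mu d]_(t in Td d) (f (expiv t) * Phi k.+1 phat qhat t)%:E)%E.
Proof.
move=> fc; have [he hn qhe hp0 hq0] := hat_feasible d0 dk lam0 Lam0 hhat.
have fec := torus_continuous fc.
pose Psi (x : X) (t : d.-tuple R) := f (expiv t) * Phi k.+1 x.1 x.2 t.
have Psi_joint (a : {ptws 'I_d -> R}) :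
    {for ((phat, qhat), a), continuous (fun xa : X * {ptws 'I_d -> R} => Psi xa.1 (tup xa.2))}.
  exact: (@weighted_ratio_cvg R _ (nbhs ((phat, qhat), a)) k.+1 _ _ _ _ _ _ _
    (lt0r_neq0 (hq0 (tup a)))
    (@cvg_near_snd X {ptws 'I_d -> R} _ (phat, qhat) a ((f \o @expiv R d) \o tup) (nbhs _) (fec a))
    (@trig_cvg_fst R d Lam phat qhat a) (@trig_cvg_snd R d Lam phat qhat a)).
have Psi_cont : continuous (Psi (phat, qhat) \o tup).
  move=> a; exact: (@weighted_ratio_cvg R _ (nbhs a) k.+1 _ _ _ _ _ _ _
    (lt0r_neq0 (hq0 (tup a))) (fec a)
    (@trig_continuous R d Lam phat a) (@trig_continuous R d Lam qhat a)).
have mPsi x : measurable_fun (Td d) (Psi x).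
  apply: measurable_funM; first exact: measurable_continuous.
  apply: measurable_funX; apply: measurable_funM; first exact: trig_measurable.
  exact: (measurableT_comp (@measurable_inv R) (trig_measurable x.2 d0)).
rewrite (integral_Imu d0 Psi_cont).
have E n : (\int[eta (N n)]_(t in Td d) (f (expiv t) * Phi k.+1 (pN n) (qN n) t)%:E =
    (mean (N n) (Psi (pN n, qN n)))%:E)%E.
  apply: integral_eta_EFin => //; apply/measurable_EFinP; exact: mPsi (pN n, qN n).
under eq_fun do rewrite E.
apply: cvg_EFin; first exact: nearW.
have := mean_cvg_joint d0 N0 Ncvg Psi_joint.
move=> h W Wn; have [[U V] /= [Uh Vh] UV] := h W Wn.
have hUV : \forall n \near \oo, U (pN n, qN n) /\ V n.
  by apply: filterI; [exact: minimizers_cvg U Uh|exact: Vh].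
suff : \forall n \near \oo, W (mean (N n) (Psi (pN n, qN n))) by [].
apply: filterS hUV => n [h1 h2].
exact: (UV ((pN n, qN n), n) (conj h1 h2)).
Qed.

End Convergence.

Theorem corollary7p7 (R : realType) (d : nat) (Lam : {fset 'rV[int]_d})
  (nu : nat) (lam : R) (c m : {ptws Lam -> R})
  (phat qhat : {ptws Lam -> R})
  (N : nat -> 'I_d -> nat) (pN qN : nat -> {ptws Lam -> R})
  (hd : (1 <= d)%N)
  (hLam0 : 0 \in Lam)
  (hLam_sym : forall k : 'rV[int]_d, k \in Lam -> - k \in Lam)
  (hnu : d%:R / 2 + 1 <= nu%:R :> R)
  (hlam : 0 < lam)
  (hc : even_coef c)
  (hm : even_coef m)
  (hPhi0 : exists Phi0 : d.-tuple R -> R,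
     [/\ (mu d).-integrable (Td d) (EFin \o Phi0),
         forall t, Td d t -> 0 <= Phi0 t,
         exists2 z0, torus d z0 &
           exists2 r : R, 0 < r &
             forall t, Td d t -> ball z0 (toC r) (expiv t) -> 0 < Phi0 t
       & forall k : Lam, toC (c k) =
           Cintegral (fun t => expi (pairing (val k) t) * toC (Phi0 t))])
  (hhat : is_solution (continuous_feasible Lam) (J (mu d) nu lam c m) phat qhat)
  (hN_pos : forall n j, (0 < N n j)%N)
  (hN_min : minN (N n) @[n --> \oo] --> \oo)
  (hN_sol : forall n, is_solution (discrete_feasible Lam (N n))
                        (J (eta (N n)) nu lam c m) (pN n) (qN n)) :
  exists s : nat -> nat,
    {homo s : a b / (a < b)%N} /\
    forall f : 'rV[Cx R]_d -> R, {within torus d, continuous f} ->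
      (\int[eta (N (s n))]_(t in Td d)
          (f (expiv t) * Phi nu (pN (s n)) (qN (s n)) t)%:E)%E @[n --> \oo]
      --> (\int[mu d]_(t in Td d) (f (expiv t) * Phi nu phat qhat t)%:E)%E.
Proof.
case: nu hnu hhat hN_sol => [|k] hnu hhat hN_sol.
  by move: hnu; rewrite leNgt ltr_wpDl// divr_ge0.
have dk : (d <= 2 * k)%N.
  rewrite -(ler_nat R) natrM mulrC -ler_pdivrMr//.
  by move: hnu; rewrite -(natr1 k) lerD2r.
exists id; split=> // f fc.
exact: (spectrum_cvg hd dk hlam hLam0 hLam_sym hhat hN_pos hN_min hN_sol fc).
Qed.
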